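(* Assume: (a) for every $x\in\mathsf X$, if $a_n\to a$ in $\mathsf A$ then $p(\,\cdot\,|x,a_n)\to p(\,\cdot\,|x,a)$ setwise; (b) $\mathsf A$ is compact; (c) $c$ and $c_n$ ($n\ge0$) are non-negative bounded measurable functions on $\mathsf X\times\mathsf A$ such that $c(x,\,\cdot\,)$ and $c_n(x,\,\cdot\,)$ are continuous and bounded on $\mathsf A$ for every $x\in\mathsf X$. Let $\pi\in RS$ and let $\{\pi^k\}_{k\ge1}$ be the quantized approximations of $\pi$. Then: (1) For every $\beta\in(0,1)$, $w_\beta(\pi^k,\mu)\to w_\beta(\pi,\mu)$ as $k\to\infty$. (2) If in addition $\sup_{\tilde\pi\in RS}\sum_{n=N+1}^\infty E^{\tilde\pi}_\mu[c_n(x_n,a_n)]\to0$ as $N\to\infty$, then $w_t(\pi^k,\mu)\to w_t(\pi,\mu)$ as $k\to\infty$. (3) Suppose in addition that ($\tilde e$) for every $\tilde\pi\in RS$, $Q_{\tilde\pi}$ has a unique invariant probability measure $\nu_{\tilde\pi}$; ($\tilde g$) $\mathsf M:=\bigcap_{\tilde\pi\in RS}\mathsf M_{\tilde\pi}\neq\emptyset$; and that at least one of the following holds: ($\tilde f1$) the set $\Gamma_{RS}:=\{\nu\in\mathcal P(\mathsf X):\nu Q_{\tilde\pi}=\nu\text{ for some }\tilde\pi\in RS\}$ is relatively sequentially compact in the setwise topology; ($\tilde f2$) there exists $x'\in\mathsf X$ such that for every Borel $B\subset\mathsf X$, $Q^n_{\tilde\pi}(B|x')\to\nu_{\tilde\pi}(B)$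 as $n\to\infty$, uniformly in $\tilde\pi\in RS$. If $\mu$ is concentrated on some $x\in\mathsf M$ (i.e. $\mu=\delta_x$), then $w_A(\pi^k,\mu)\to w_A(\pi,\mu)$ as $k\to\infty$.
   Context: Markov decision process: the state space $\mathsf X$ and action space $\mathsf A$ are Polish (complete separable metric) spaces with Borel $\sigma$-algebras; every action in $\mathsf A$ is admissible in every state; $p(\,\cdot\,|x,a)$ is a stochastic kernel on $\mathsf X$ given $\mathsf X\times\mathsf A$ (transition probability); $\mu$ is an arbitrary fixed initial distribution on $\mathsf X$. ''Measurable'' means Borel measurable. $d_{\mathsf A}$ is the metric of $\mathsf A$; $\mathcal P(\mathsf X)$ is the set of Borel probability measures on $\mathsf X$. $RS$ is the set of randomized stationary policies: $\pi\in RS$ is given (induced) by a stochastic kernel $\eta(da|x)$ on $\mathsf A$ given $\mathsf X$, and at each time $n$ the action $a_n$ has conditional law $\eta(\,\cdot\,|x_n)$ given the past. $P^\pi_\mu$ (expectation $E^\pi_\mu$) is the law of the process $(x_0,a_0,x_1,a_1,\dots)$ with $x_0\sim\mu$, actions chosen by $\pi$, and $x_{n+1}\sim p(\,\cdot\,|x_n,a_n)$ given the past. For $\pi\in RS$ induced by $\eta$, $Q_\pi(\,\cdot\,|x)=\int_{\mathsf A}p(\,\cdot\,|x,a)\,\eta(da|x)$ is the induced stochastic kernel on $\mathsf X$ and $Q^n_\pi$ its $n$-step iterate; $\nu Q_\pi=\int Q_\pi(\,\cdot\,|x)\,\nu(dx)$. Costs, with measurable $c,c_n:\mathsf X\times\mathsf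 A\to[0,\infty)$: $w_t(\pi,\mu)=E^\pi_\mu[\sum_{n=0}^\infty c_n(x_n,a_n)]$, $w_\beta(\pi,\mu)=E^\pi_\mu[\sum_{n=0}^\infty\beta^nc(x_n,a_n)]$, $w_A(\pi,\mu)=\limsup_{N\to\infty}\frac1NE^\pi_\mu[\sum_{n=0}^Nc(x_n,a_n)]$. For $\pi\in RS$ induced by $\eta$ with invariant probability measure $\nu_\pi$, $\mathsf M_\pi$ is the set of all $x\in\mathsf X$ such that $\lim_{N\to\infty}\frac1N\sum_{n=0}^{N-1}E^\pi_x[c(x_n,a_n)]=\int_{\mathsf X}\int_{\mathsf A}c(y,a)\,\eta(da|y)\,\nu_\pi(dy)$. Setwise convergence $\nu_n\to\nu$ means $\nu_n(B)\to\nu(B)$ for every measurable $B$. A set $\Gamma\subset\mathcal P(\mathsf X)$ is relatively sequentially compact in the setwise topology if every sequence in $\Gamma$ has a subsequence converging setwise to an element of $\mathcal P(\mathsf X)$. Quantized approximations: fix for each $k\ge1$ a finite set $\Lambda_k=\{a_1,\dots,a_{m_k}\}\subset\mathsf A$ with $\min_{1\le i\le m_k}d_{\mathsf A}(a,a_i)<1/k$ for all $a\in\mathsf A$ (possible since $\mathsf A$ is compact). Let $\pi\in RS$ be induced by $\eta$. There is a measurable $\mathsf f:\mathsf X\times[0,1]\to\mathsf A$ with $\eta(E|x)=m(\{z:\mathsf f(x,z)\in E\})$ for all Borel $E\subset\mathsf A$, where $m$ is Lebesgue measure on $[0,1]$; fix such an $\mathsf f$. Let $\mathsf q_k:\mathsf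 X\times[0,1]\to\Lambda_k$, $\mathsf q_k(x,z)=\arg\min_{a\in\Lambda_k}d_{\mathsf A}(\mathsf f(x,z),a)$, with ties broken so that $\mathsf q_k$ is (jointly) measurable. The $k$-th quantized approximation $\pi^k\in RS$ of $\pi$ is the policy induced by the stochastic kernel $\eta_k(\,\cdot\,|x)=\int_{[0,1]}\delta_{\mathsf q_k(x,z)}(\,\cdot\,)\,m(dz)$. *)

(* Defs.v *)
From HB Require Import structures.
From mathcomp Require Import all_boot all_order all_algebra.
From mathcomp Require Import all_classical all_reals all_analysis.
From mathcomp Require Import measurable_realfun giry.

Set Implicit Arguments.
Unset Strict Implicit.
Unset Printing Implicit Defensive.
Import Order.TTheory GRing.Theory Num.Theory.
Import numFieldNormedType.Exports.

Local Open Scope classical_set_scope.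
Local Open Scope ring_scope.

(* Polish space with its Borel sigma-algebra: a metric space that is separable,
   complete for its given metric, and whose measurable sets are generated by
   the open sets. *)
HB.mixin Record Metric_isPolishBorel (R : realType) (d : measure_display) T
    & Metric R T & Measurable d T := {
  polish_separable : exists D : set T, countable D /\ dense D ;
  polish_complete :
    forall F : set_system T, ProperFilter F -> cauchy F -> cvg F ;
  polish_measurableE : @measurable d T = <<s @open T >>
}.

#[short(type="polishType")]
HB.structure Definition Polish (R : realType) (d : measure_display) :=
  { T of Metric R T & Measurable d T & Metric_isPolishBorel R d T }.

(* Ionescu-Tulcea in the following form: [step j] resamples the j-th coordinate
   of a point of S, [trunc j] forgets the coordinates >= j, and [it_law n] is
   the law after n resamplings started from w0. There is a probability measure
   on S that agrees with [it_law j] on the functions of the first j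
   coordinates. *)
Section ionescu_tulcea.
Local Open Scope ereal_scope.
Context d (S : measurableType d) (R : realType).
Variables (step : nat -> S -> giry S R) (trunc : nat -> S -> S) (w0 : S).
Hypothesis mstep : forall j, measurable_fun [set: S] (step j).
Hypothesis step1 : forall j w, step j w setT = 1.
Hypothesis mtrunc : forall j, measurable_fun [set: S] (trunc j).
Hypothesis trunc_le : forall i j w, (i <= j)%N -> trunc i (trunc j w) = trunc i w.
Hypothesis trunc_glue : forall w_ : nat -> S,
  (forall j, trunc j (w_ j.+1) = trunc j (w_ j)) ->
  exists w, forall j, trunc j w = trunc j (w_ j).
Hypothesis le_step : forall j w (f g : S -> \bar R),
  measurable_fun [set: S] f -> measurable_fun [set: S] g ->
  (forall v, 0 <= f v) -> (forall v, 0 <= g v) ->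
  (forall v, trunc j v = trunc j w -> f v <= g v) ->
  \int[step j w]_v f v <= \int[step j w]_v g v.

Let dep U (j : nat) (f : S -> U) := forall w, f (trunc j w) = f w.

Let dep_le U i j (f : S -> U) : (i <= j)%N -> dep i f -> dep j f.
Proof. by move=> ij fi w; rewrite -fi trunc_le// fi. Qed.

Fixpoint it_law (n : nat) : giry S R :=
  if n is m.+1 then giry_bind (it_law m) (mstep m) else giry_ret w0.

Let E j (f : S -> \bar R) w := \int[step j w]_v f v.

Let mE j f : measurable_fun [set: S] f -> (forall v, 0 <= f v) ->
  measurable_fun [set: S] (E j f).
Proof.
move=> mf f0; rewrite /E.
exact: (measurableT_comp (measurable_giry_int mf f0) (mstep j)).
Qed.

Let E_ge0 j f w : (forall v, 0 <= f v) -> 0 <= E j f w.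
Proof. by move=> f0; exact: integral_ge0. Qed.

Let E_dep j f w : measurable_fun [set: S] f -> (forall v, 0 <= f v) ->
  dep j f -> E j f w = f w.
Proof.
move=> mf f0 fj.
have Ec : \int[step j w]_v (cst (f w)) v = f w.
  by rewrite integral_cst// [X in _ * X](step1 j w) mule1.
rewrite -[RHS]Ec; apply/eqP; rewrite eq_le; apply/andP; split;
  apply: le_step => //= v vw.
- by rewrite -(fj v) vw fj.
- by rewrite -(fj v) vw fj.
Qed.

Let int_lawS n f : measurable_fun [set: S] f -> (forall v, 0 <= f v) ->
  \int[it_law n.+1]_v f v = \int[it_law n]_v E n f v.
Proof. by move=> mf f0; exact: giry_int_bind. Qed.

Let it_law1 n : it_law n setT = 1.
Proof.
have intT (P : giry S R) : \int[P]_v cst 1 v = P setT.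
  by rewrite integral_cst// mul1e.
elim: n => [|n IH]; first by rewrite /= [LHS]diracT.
rewrite -intT int_lawS// -[RHS]IH -[RHS]intT; apply: eq_integral => w _.
by rewrite /E intT; exact: step1.
Qed.

Let int_law_dep j n f : measurable_fun [set: S] f -> (forall v, 0 <= f v) ->
  dep j f -> (j <= n)%N -> \int[it_law n]_v f v = \int[it_law j]_v f v.
Proof.
move=> mf f0 fj /subnK <-; elim: (n - j)%N => [//|k IH].
rewrite addSn int_lawS// -IH; apply: eq_integral => w _.
by apply: E_dep => //; apply: dep_le fj; rewrite leq_addl.
Qed.

Let indE (P : giry S R) C : measurable C ->
  P C = \int[P]_v (\1_C v)%:E.
Proof. by move=> mC; rewrite integral_indic// setIT. Qed.

Let mind C : measurable C -> measurable_fun [set: S] (fun v : S => (\1_C v)%:E : \bar R).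
Proof. by move=> mC; exact/measurable_EFinP/measurable_indic. Qed.

Let ind_ge0 (C : set S) v : 0 <= (\1_C v)%:E :> \bar R.
Proof. by rewrite lee_fin. Qed.

Let dep_ind j (C : set S) : dep j C -> dep j (fun v => (\1_C v)%:E : \bar R).
Proof. 
move=> Cj w; rewrite /= !indicE.
by have -> : (trunc j w \in C) = (w \in C) by apply/idP/idP; rewrite !inE Cj. Qed.

Let it_law_dep i j C : measurable C -> dep i C -> dep j C ->
  it_law i C = it_law j C.
Proof.
move=> mC Ci Cj; wlog ij : i j Ci Cj / (i <= j)%N.
  by move=> H; case/orP: (leq_total i j) => ?; [|symmetry]; exact: H.
rewrite !indE//; symmetry; apply: int_law_dep ij => //.
- exact: mind.
- exact: dep_ind.
Qed.

Definition it_cyl : Type := S.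
HB.instance Definition _ := Pointed.on it_cyl.
Definition it_cyl_measurable : set (set it_cyl) :=
  [set C | @measurable d S C /\ exists j, dep j (C : set S)].

Let cyl0 : it_cyl_measurable set0.
Proof. by split; [exact: measurable0|exists 0%N]. Qed.

Let cylU : setU_closed it_cyl_measurable.
Proof.
move=> B C [mB [i Bi]] [mC [j Cj]]; split; first exact: measurableU.
exists (maxn i j) => w; rewrite /setU/=.
by rewrite (dep_le (leq_maxl i j) Bi) (dep_le (leq_maxr i j) Cj).
Qed.

Let cylC : setC_closed it_cyl_measurable.
Proof.
move=> B [mB [i Bi]]; split; first exact: measurableC.
by exists i => w; rewrite /setC/= Bi.
Qed.

Definition it_display : measure_display. Proof. by constructor. Qed.

HB.instance Definition _ := @isAlgebraOfSets.Build it_display it_cyl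
  it_cyl_measurable cyl0 cylU cylC.

Definition it_content (C : set it_cyl) : \bar R :=
  if pselect (exists j, dep j (C : set S)) is left e
  then it_law (projT1 (cid e)) (C : set S) else 0.

Let contentE j C : measurable (C : set S) -> dep j (C : set S) ->
  it_content C = it_law j C.
Proof.
move=> mC Cj; rewrite /it_content; case: pselect => [e|]; last by case; exists j.
by case: cid => i Ci /=; exact: it_law_dep.
Qed.

Let content_ge0 C : 0 <= it_content C.
Proof. by rewrite /it_content; case: pselect. Qed.

Let content_additive : measure_function.semi_additive it_content.
Proof.
have c0 : it_content set0 = 0 by rewrite (@contentE 0%N)// measure0.
apply/(additive2P c0) => B C [mB [i Bi]] [mC [j Cj]] BC.
have Bm := dep_le (leq_maxl i j) Bi; have Cm := dep_le (leq_maxr i j) Cj.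
rewrite (contentE mB Bm) (contentE mC Cm) -measureU//.
apply: contentE; first exact: measurableU.
by move=> w; rewrite /setU/= Bm Cm.
Qed.

HB.instance Definition _ := isContent.Build _ it_cyl R it_content
  content_ge0 content_additive.

Fixpoint it_val k n (f : S -> \bar R) : S -> \bar R :=
  if n is m.+1 then E k (it_val k.+1 m f) else f.

Let val_ge0 k n f : (forall v, 0 <= f v) -> forall v, 0 <= it_val k n f v.
Proof. by elim: n k => [|n IH] k f0 v //=; apply: E_ge0; exact: IH. Qed.

Let mval k n f : measurable_fun [set: S] f -> (forall v, 0 <= f v) ->
  measurable_fun [set: S] (it_val k n f).
Proof.
move=> mf f0; elim: n k => [|n IH] k //=.
by apply: mE; [exact: IH|exact: val_ge0].
Qed.

Let int_val k n f : measurable_fun [set: S] f -> (forall v, 0 <= f v) ->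
  \int[it_law k]_v it_val k n f v = \int[it_law (k + n)]_v f v.
Proof.
move=> mf f0; elim: n k => [|n IH] k; first by rewrite addn0.
by rewrite /= -int_lawS ?IH ?addnS ?addSn//; [exact: mval|exact: val_ge0].
Qed.

Let tval N k f := it_val k (N - k) f.

Let tvalE N k f w : measurable_fun [set: S] f -> (forall v, 0 <= f v) ->
  dep N f -> tval N k f w = E k (tval N k.+1 f) w.
Proof.
move=> mf f0 fN; rewrite /tval; case: (ltnP k N) => kN.
  by rewrite -[X in it_val k X](subnSK kN).
have /eqP -> : (N - k == 0)%N by rewrite subn_eq0.
have /eqP -> : (N - k.+1 == 0)%N by rewrite subn_eq0 leqW.
by rewrite /= E_dep//; exact: dep_le fN.
Qed.

Let tval_end N k f w : (N <= k)%N -> tval N k f w = f w.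
Proof. by rewrite -subn_eq0 /tval => /eqP ->. Qed.

Let content_tval N C : measurable C -> dep N C ->
  it_content C = tval N 0 (fun v => (\1_C v)%:E) w0.
Proof.
move=> mC CN; rewrite (contentE mC CN) indE// /tval subn0.
rewrite -[N in LHS]add0n -int_val ?integral_dirac ?diracT ?mul1e//.
- by apply: mval => //; exact: mind.
- exact: mind.
Qed.

Let content_ssub : measurable_subset_sigma_subadditive it_content.
Proof.
move=> C F mF [mC [N CN]] CF; apply/negP => /negP; rewrite -ltNge => lt0.
have mF1 i : measurable (F i : set S) by have [] := mF i.
have /choice[M FM] : forall i, exists j, dep j (F i : set S).
  by move=> i; have [] := mF i.
pose f i (v : S) : \bar R := (\1_(F i) v)%:E.
pose g (v : S) : \bar R := (\1_C v)%:E.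
pose G k v := \sum_(0 <= i <oo) tval (M i) k (f i) v.
have f0 i v : 0 <= f i v by exact: ind_ge0.
have g0 v : 0 <= g v by exact: ind_ge0.
have mf i : measurable_fun [set: S] (f i) by exact: mind.
have mg : measurable_fun [set: S] g by exact: mind.
have mtf i k : measurable_fun [set: S] (tval (M i) k (f i)) by exact: mval _ _ (mf i) (ind_ge0 _).
have tf0 i k v : 0 <= tval (M i) k (f i) v by exact: val_ge0 _ _ (ind_ge0 _) v.
have GE k w : G k w = E k (G k.+1) w.
  rewrite /G /E integral_nneseries//.
  apply: eq_eseriesr => i _; apply: tvalE.
  - exact: mf.
  - exact: ind_ge0.
  - exact: (dep_ind (FM i)).
have gE k w : tval N k g w = E k (tval N k.+1 g) w.
  by apply: tvalE => //; exact: (dep_ind CN).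
have mG k : measurable_fun [set: S] (G k) by exact: ge0_emeasurable_sum.
have G0 k v : 0 <= G k v by apply: nneseries_ge0.
have next (k : nat) (w : S) : exists v, G k w < tval N k g w ->
    trunc k v = trunc k w /\ G k.+1 v < tval N k.+1 g v.
  have [h|h] := pselect (exists v, trunc k v = trunc k w /\ G k.+1 v < tval N k.+1 g v).
    by have [v ?] := h; exists v.
  exists w; rewrite GE gE ltNge => /negP; case; apply: le_step => //.
  - exact: mval.
  - exact: val_ge0.
  - move=> v vw; rewrite leNgt; apply/negP => Gv.
    by apply: h; exists v.
have [nx nxP] : {nx : nat -> S -> S | forall k w, G k w < tval N k g w ->
    trunc k (nx k w) = trunc k w /\ G k.+1 (nx k w) < tval N k.+1 g (nx k w)}.
  exists (fun k w => projT1 (cid (next k w))) => k w.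
  exact: (projT2 (cid (next k w))).
pose w_ := fix w_ n := if n is m.+1 then nx m (w_ m) else w0.
have w_lt k : G k (w_ k) < tval N k g (w_ k).
  elim: k => [|k IH]; last by have [] := nxP k _ IH.
  rewrite /= -content_tval//; apply: le_lt_trans lt0.
  rewrite le_eqVlt; apply/orP; left; apply/eqP.
  by apply: eq_eseriesr => i _; rewrite (@content_tval (M i)).
have [w wP] : exists w, forall j, trunc j w = trunc j (w_ j).
  by apply: trunc_glue => j; have [] := nxP j _ (w_lt j).
have Cw : C w.
  have := w_lt N; rewrite tval_end// /g -(CN w) wP CN.
  move=> /(le_lt_trans (G0 _ _)); rewrite indicE lte_fin ltr0n lt0b inE//.
have [i _ Fiw] := CF w Cw.
pose K := maxn N (M i).
have := w_lt K; rewrite tval_end ?leq_maxl// => Glt.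
have : f i (w_ K) <= G K (w_ K).
  rewrite -(@tval_end (M i) K) ?leq_maxr//.
  rewrite /G; have -> := @nneseriesD1 R (fun l => tval (M l) K (f l) (w_ K)) i xpredT
    (fun l _ => tf0 l K (w_ K)) isT.
  by apply: leeDl; apply: nneseries_ge0 => l _ _; exact: tf0.
move=> /le_lt_trans/(_ Glt); rewrite /f /g !indicE lte_fin ltr_nat.
have -> : w_ K \in F i.
  have FK := dep_le (leq_maxr N (M i)) (FM i).
  by rewrite inE -FK -wP FK.
by case: (_ \in C).
Qed.

HB.instance Definition _ :=
  Content_SigmaSubAdditive_isMeasure.Build _ _ _ it_content content_ssub.

Hypothesis gen_cyl : @measurable d S `<=` <<s it_cyl_measurable >>.

Definition it_ext (C : set S) : \bar R := measure_extension it_content C.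

Let ext_ge0 C : 0 <= it_ext C. Proof. exact: measure_ge0. Qed.

Let ext0 : it_ext set0 = 0. Proof. exact: measure0. Qed.

Let ext_sigma_additive : semi_sigma_additive it_ext.
Proof.
move=> F mF tF mUF.
apply: (@measure_semi_sigma_additive _ _ _ (measure_extension it_content)) => //.
- by move=> i; apply: gen_cyl; exact: mF.
- exact: gen_cyl mUF.
Qed.

HB.instance Definition _ := isMeasure.Build _ _ _ it_ext
  ext0 ext_ge0 ext_sigma_additive.

Let extE j C : measurable C -> dep j C -> it_ext C = it_law j C.
Proof.
move=> mC Cj; rewrite /it_ext /measure_extension measurable_mu_extE.
  exact: contentE.
by split => //; exists j.
Qed.

Let extT : it_ext setT = 1.
Proof. by rewrite (@extE 0%N)//; exact: it_law1. Qed.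

HB.instance Definition _ := Measure_isProbability.Build _ _ _ it_ext extT.

Lemma ionescu_tulcea : exists P : probability S R,
  forall j (f : S -> \bar R), measurable_fun [set: S] f ->
    (forall v, 0 <= f v) -> (forall w, f (trunc j w) = f w) ->
    \int[P]_v f v = \int[it_law j]_v f v.
Proof.
exists it_ext => j f mf f0 fj.
have trE (m : {measure set S -> \bar R}) :
    \int[m]_v f v = \int[pushforward m (trunc j)]_v f v.
  rewrite ge0_integral_pushforward//.
  by rewrite preimage_setT; apply: eq_integral => v _ /=; rewrite fj.
rewrite [LHS]trE [RHS]trE; apply: eq_measure_integral => C mC _.
apply: extE; first by rewrite -[X in measurable X]setTI; exact: mtrunc.
by move=> w; rewrite /preimage/= trunc_le.
Qed.

Lemma integral_it_lawS n (f : S -> \bar R) : measurable_fun [set: S] f ->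
  (forall v, 0 <= f v) ->
  \int[it_law n.+1]_v f v = \int[it_law n]_v (\int[step n v]_u f u).
Proof. exact: int_lawS. Qed.

End ionescu_tulcea.

Section resample.
Local Open Scope ereal_scope.
Context d (S : measurableType d) d' (Z : measurableType d') (R : realType).
Variables (k : R.-pker S ~> Z) (u : S * Z -> S).
Hypothesis mu : measurable_fun [set: S * Z] u.

Definition resample (w : S) : set S -> \bar R := mkcomp k (kdirac mu) w.

HB.instance Definition _ w := Measure.on (resample w).

Let resampleT w : resample w setT = 1.
Proof.
rewrite /resample/= /kcomp/=; under eq_integral do rewrite /kdirac diracT.
by rewrite integral_cst// mul1e prob_kernel.
Qed.

HB.instance Definition _ w :=
  Measure_isProbability.Build _ _ _ (resample w) (resampleT w).

Lemma integral_resample w (f : S -> \bar R) : measurable_fun [set: S] f ->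
  (forall x, 0 <= f x) -> \int[resample w]_x f x = \int[k w]_z f (u (w, z)).
Proof.
move=> mf f0; rewrite (@integral_kcomp _ _ _ _ _ _ _ k (kdirac mu))//.
apply: eq_integral => z _.
by rewrite integral_dirac// diracT mul1e.
Qed.

Lemma measurable_resample :
  measurable_fun [set: S] (resample : S -> giry S R).
Proof.
apply: measurable_giry_codensity => // B mB.
exact: (measurable_kernel (mkcomp k (kdirac mu)) B mB).
Qed.

End resample.

Section kreindex.
Context d d' d'' (T : measurableType d) (T' : measurableType d')
  (Z : measurableType d'') (R : realType).
Variables (k : R.-pker T' ~> Z) (f : T -> T').
Hypothesis mf : measurable_fun [set: T] f.

Definition kreindex & measurable_fun [set: T] f := fun t => k (f t).

Let kreindex_measurable U : measurable U ->
  measurable_fun [set: T] (kreindex mf ^~ U).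
Proof.
move=> mU; exact: (measurableT_comp (measurable_kernel k U mU) mf).
Qed.

HB.instance Definition _ :=
  isKernel.Build _ _ _ _ _ (kreindex mf) kreindex_measurable.

Let kreindex1 t : kreindex mf t setT = 1%E.
Proof. exact: prob_kernel. Qed.

HB.instance Definition _ :=
  Kernel_isProbability.Build _ _ _ _ _ (kreindex mf) kreindex1.

End kreindex.

Section path_space.
Context (dX dA : measure_display).
Context (X : measurableType dX) (A : measurableType dA).

Definition path_cylinder : set (set (nat -> X * A)) :=
  [set C | exists n (B : set (X * A)), measurable B /\ C = [set w | B (w n)]].

Definition traj := g_sigma_algebraType path_cylinder.

(* [state_past n] is the sigma-algebra generated by (x_0, a_0, ..., x_n), and
   [action_past n] the one generated by (x_0, a_0, ..., x_n, a_n). *)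
Definition state_cylinder (n : nat) : set (set traj) :=
  [set C | exists2 B : set X, measurable B & C = [set w | B (w n).1]].

Definition action_cylinder (n : nat) : set (set traj) :=
  [set C | exists2 B : set A, measurable B & C = [set w | B (w n).2]].

Definition state_past (n : nat) : set (set traj) :=
  <<s (\bigcup_(i in [set i | (i <= n)%N]) state_cylinder i) `|`
      (\bigcup_(i in [set i | (i < n)%N]) action_cylinder i) >>.

Definition action_past (n : nat) : set (set traj) :=
  <<s (\bigcup_(i in [set i | (i <= n)%N]) state_cylinder i) `|`
      (\bigcup_(i in [set i | (i <= n)%N]) action_cylinder i) >>.

Lemma measurable_coord n : measurable_fun [set: traj] (fun w : traj => w n).
Proof.
by move=> _ B mB; rewrite setTI; apply: sub_sigma_algebra; exists n, B.
Qed.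

Lemma measurable_path d (T : measurableType d) (f : T -> traj) :
  (forall n, measurable_fun [set: T] (fun t => f t n)) ->
  measurable_fun [set: T] f.
Proof.
move=> mf; apply: (@measurability _ _ T traj _ _ path_cylinder) => //=.
by move=> _ [_ [n [B [mB ->]]] <-]; exact: (mf n _ _ mB).
Qed.

(* The coordinates are ordered x_0, a_0, x_1, a_1, ...: [path_trunc j] keeps the
   first j of them. *)
Definition set_state n (wx : traj * X) : traj :=
  fun m => if m == n then (wx.2, (wx.1 m).2) else wx.1 m.

Definition set_action n (wa : traj * A) : traj :=
  fun m => if m == n then ((wa.1 m).1, wa.2) else wa.1 m.

Definition path_trunc j (w : traj) : traj :=
  fun m => (if (m.*2 < j)%N then (w m).1 else point,
            if (m.*2.+1 < j)%N then (w m).2 else point).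

Lemma measurable_set_state n : measurable_fun [set: traj * X] (set_state n).
Proof.
apply: measurable_path => m; rewrite /set_state.
have mm : measurable_fun [set: traj * X] (fun wx => wx.1 m).
  exact: (measurableT_comp (measurable_coord m) measurable_fst).
case: (m == n) => //.
apply: (measurable_fun_pair (f := snd)); first exact: measurable_snd.
exact: (measurableT_comp measurable_snd mm).
Qed.

Lemma measurable_set_action n : measurable_fun [set: traj * A] (set_action n).
Proof.
apply: measurable_path => m; rewrite /set_action.
have mm : measurable_fun [set: traj * A] (fun wx => wx.1 m).
  exact: (measurableT_comp (measurable_coord m) measurable_fst).
case: (m == n) => //.
apply: (measurable_fun_pair (g := snd)); last exact: measurable_snd.
exact: (measurableT_comp measurable_fst mm).
Qed.

Lemma measurable_trunc j : measurable_fun [set: traj] (path_trunc j).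
Proof.
apply: measurable_path => m; rewrite /path_trunc.
apply: measurable_fun_pair; case: (_ < _)%N => //.
- exact: (measurableT_comp measurable_fst (measurable_coord m)).
- exact: (measurableT_comp measurable_snd (measurable_coord m)).
Qed.

Lemma path_trunc_le i j w : (i <= j)%N -> path_trunc i (path_trunc j w) = path_trunc i w.
Proof.
move=> ij; apply/funext => m; rewrite /path_trunc/=; congr (_, _).
- by case: ifP => // mi; rewrite (leq_trans mi).
- by case: ifP => // mi; rewrite (leq_trans mi).
Qed.

Lemma path_trunc_fst j w w' n : (n.*2 < j)%N -> path_trunc j w = path_trunc j w' ->
  (w n).1 = (w' n).1.
Proof. by move=> nj /(congr1 (fun w => (w n).1)); rewrite /path_trunc/= nj. Qed.

Lemma path_trunc_snd j w w' n : (n.*2.+1 < j)%N -> path_trunc j w = path_trunc j w' ->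
  (w n).2 = (w' n).2.
Proof. by move=> nj /(congr1 (fun w => (w n).2)); rewrite /path_trunc/= nj. Qed.

Lemma path_trunc_eq j w w' :
  (forall n, (n.*2 < j)%N -> (w n).1 = (w' n).1) ->
  (forall n, (n.*2.+1 < j)%N -> (w n).2 = (w' n).2) ->
  path_trunc j w = path_trunc j w'.
Proof.
move=> w1 w2; apply/funext => m; rewrite /path_trunc/=; congr (_, _).
- by case: ifP => // /w1.
- by case: ifP => // /w2.
Qed.

Lemma path_trunc_glue (w_ : nat -> traj) :
  (forall j, path_trunc j (w_ j.+1) = path_trunc j (w_ j)) ->
  exists w, forall j, path_trunc j w = path_trunc j (w_ j).
Proof.
move=> ww; have wle i j : (i <= j)%N -> path_trunc i (w_ j) = path_trunc i (w_ i).
  move=> /subnK <-; elim: (j - i)%N => [//|k IH].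
  by rewrite addSn -(path_trunc_le _ (leq_addl k i)) ww path_trunc_le ?leq_addl.
exists (fun m => ((w_ m.*2.+1 m).1, (w_ m.*2.+2 m).2)) => j.
apply: path_trunc_eq => n nj /=; symmetry.
- exact: path_trunc_fst (wle _ _ nj).
- exact: path_trunc_snd (wle _ _ nj).
Qed.

Lemma path_trunc_set_state n w x :
  path_trunc n.*2 (set_state n (w, x)) = path_trunc n.*2 w.
Proof.
by apply: path_trunc_eq => m; rewrite /set_state/=; case: eqP => // ->; rewrite ltnn.
Qed.

Lemma path_trunc_set_action n w a :
  path_trunc n.*2.+1 (set_action n (w, a)) = path_trunc n.*2.+1 w.
Proof.
by apply: path_trunc_eq => m; rewrite /set_action/=; case: eqP => // ->; rewrite ltnn.
Qed.

Lemma state_past_trunc n F : state_past n F ->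
  measurable F /\ forall w, F (path_trunc n.*2.+1 w) = F w.
Proof.
pose G : set (set traj) :=
  [set C | measurable C /\ forall w, C (path_trunc n.*2.+1 w) = C w].
suff : state_past n `<=` G by exact.
apply: smallest_sub.
  split.
  - by split.
  - move=> C [mC CE]; rewrite setTD; split; first exact: measurableC.
    by move=> w; rewrite /setC/= CE.
  - move=> C /all_and2[mC CE]; split; first exact: bigcupT_measurable.
    by move=> w; apply/propext; split => -[i _ Ci]; exists i => //;
      move: Ci; rewrite CE.
move=> C [[i /= ni [B mB ->]]|[i /= ni [B mB ->]]]; split.
- rewrite -[X in measurable X]setTI.
  exact: (measurableT_comp measurable_fst (measurable_coord i)).
- by move=> w /=; rewrite /path_trunc/= ltnS leq_double ni.
- rewrite -[X in measurable X]setTI.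
  exact: (measurableT_comp measurable_snd (measurable_coord i)).
- by move=> w /=; rewrite /path_trunc/= ltnS ltn_double ni.
Qed.

Lemma action_past_trunc n F : action_past n F ->
  measurable F /\ forall w, F (path_trunc n.*2.+2 w) = F w.
Proof.
pose G : set (set traj) :=
  [set C | measurable C /\ forall w, C (path_trunc n.*2.+2 w) = C w].
suff : action_past n `<=` G by exact.
apply: smallest_sub.
  split.
  - by split.
  - move=> C [mC CE]; rewrite setTD; split; first exact: measurableC.
    by move=> w; rewrite /setC/= CE.
  - move=> C /all_and2[mC CE]; split; first exact: bigcupT_measurable.
    by move=> w; apply/propext; split => -[i _ Ci]; exists i => //;
      move: Ci; rewrite CE.
move=> C [[i /= ni [B mB ->]]|[i /= ni [B mB ->]]]; split.
- rewrite -[X in measurable X]setTI.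
  exact: (measurableT_comp measurable_fst (measurable_coord i)).
- by move=> w /=; rewrite /path_trunc/= ltnS (leq_trans _ (leqnSn _)) ?leq_double.
- rewrite -[X in measurable X]setTI.
  exact: (measurableT_comp measurable_snd (measurable_coord i)).
- by move=> w /=; rewrite /path_trunc/= !ltnS leq_double ni.
Qed.

Lemma path_gen : @measurable _ traj `<=`
  <<s [set C : set traj | measurable C /\ exists j, forall w, C (path_trunc j w) = C w] >>.
Proof.
apply: sub_smallest2r; first exact: smallest_sigma_algebra.
move=> _ [n [B [mB ->]]]; split.
  rewrite -[X in measurable X]setTI; exact: (measurable_coord n).
exists n.*2.+2 => w; rewrite /path_trunc/=.
by rewrite ltnSn ltnS leqnSn -surjective_pairing.
Qed.

End path_space.

Section strategic_law.
Local Open Scope ereal_scope.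
Context (dX dA : measure_display) (R : realType).
Context (X : measurableType dX) (A : measurableType dA).
Variables (p : R.-pker (X * A) ~> X) (eta : R.-pker X ~> A).
Variable mu : probability X R.

(* x_0 has law mu; given (x_0, a_0, ..., x_n) the action a_n has law
   eta(. | x_n); given (x_0, a_0, ..., x_n, a_n) the state x_(n+1) has law
   p(. | x_n, a_n). *)
Definition is_strategic_law (P : probability (traj X A) R) : Prop :=
  [/\ forall B, measurable B -> P [set w | B (w 0%N).1] = mu B,
      forall n F B, state_past n F -> measurable B ->
        P (F `&` [set w | B (w n).2]) = \int[P]_(w in F) eta (w n).1 B
    & forall n F B, action_past n F -> measurable B ->
        P (F `&` [set w | B (w n.+1).1]) = \int[P]_(w in F) p (w n) B].

Let S := traj X A.

Let state_kernel (n : nat) : R.-pker S ~> X :=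
  if n is m.+1 then kreindex p (measurable_coord m)
  else kprobability (measurable_cst (mu : pprobability X R)).

Let action_kernel (n : nat) : R.-pker S ~> A :=
  kreindex eta (measurableT_comp measurable_fst (measurable_coord n)).

Let step (j : nat) : S -> giry S R :=
  if odd j then
    (resample (action_kernel j./2) (measurable_set_action j./2) : S -> giry S R)
  else
    (resample (state_kernel j./2) (measurable_set_state j./2) : S -> giry S R).

Let mstep j : measurable_fun [set: S] (step j).
Proof. by rewrite /step; case: (odd j); exact: measurable_resample. Qed.

Let step1 j w : step j w setT = 1.
Proof. by rewrite /step; case: (odd j); exact: probability_setT. Qed.

Let le_resample d (Z : measurableType d) (k : R.-pker S ~> Z) (u : S * Z -> S)
    (mu_u : measurable_fun [set: S * Z] u) (j : nat) (w : S) (f g : S -> \bar R) :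
  (forall z, path_trunc j (u (w, z)) = path_trunc j w) ->
  measurable_fun [set: S] f -> measurable_fun [set: S] g ->
  (forall v, 0 <= f v) -> (forall v, 0 <= g v) ->
  (forall v, path_trunc j v = path_trunc j w -> f v <= g v) ->
  \int[resample k mu_u w]_v f v <= \int[resample k mu_u w]_v g v.
Proof.
move=> tu mf mg f0 g0 fg; rewrite !integral_resample//.
have mw : measurable_fun [set: Z] (fun z => u (w, z)).
  exact: (measurableT_comp mu_u (pair1_measurable w)).
apply: ge0_le_integral => //.
- exact: (measurableT_comp mf mw).
- exact: (measurableT_comp mg mw).
- by move=> z _; exact: fg.
Qed.

Let le_step j w (f g : S -> \bar R) :
  measurable_fun [set: S] f -> measurable_fun [set: S] g ->
  (forall v, 0 <= f v) -> (forall v, 0 <= g v) ->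
  (forall v, path_trunc j v = path_trunc j w -> f v <= g v) ->
  \int[step j w]_v f v <= \int[step j w]_v g v.
Proof.
rewrite /step; have := odd_double_half j; case: (odd j) => /= jE.
- by apply: le_resample => a; rewrite -{1 3}jE add1n path_trunc_set_action.
- by apply: le_resample => x; rewrite -{1 3}jE add0n path_trunc_set_state.
Qed.

Let law_exists : exists P : probability S R,
  forall j (f : S -> \bar R), measurable_fun [set: S] f ->
    (forall v, 0 <= f v) -> (forall w, f (path_trunc j w) = f w) ->
    \int[P]_v f v = \int[it_law (point : S) mstep j]_v f v.
Proof.
apply: (@ionescu_tulcea _ _ _ _ (@path_trunc _ _ X A)) => //.
- exact: measurable_trunc.
- exact: path_trunc_le.
- exact: path_trunc_glue.
- exact: path_gen.
Qed.

Let disint (P : probability S R)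
  (HP : forall j (f : S -> \bar R), measurable_fun [set: S] f ->
    (forall v, 0 <= f v) -> (forall w, f (path_trunc j w) = f w) ->
    \int[P]_v f v = \int[it_law (point : S) mstep j]_v f v)
  j d (Z : measurableType d) (k : R.-pker S ~> Z) (u : S * Z -> S)
  (mu_u : measurable_fun [set: S * Z] u) (pr : S -> Z) (F : set S) (B : set Z) :
  (forall w, step j w = resample k mu_u w) ->
  measurable_fun [set: S] pr ->
  (forall w z, pr (u (w, z)) = z) ->
  (forall w z, path_trunc j (u (w, z)) = path_trunc j w) ->
  (forall w, pr (path_trunc j.+1 w) = pr w) ->
  (forall w, k (path_trunc j w) B = k w B) ->
  measurable F -> (forall w, F (path_trunc j w) = F w) -> measurable B ->
  P (F `&` [set w | B (pr w)]) = \int[P]_(w in F) k w B.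
Proof.
move=> stepE mpr pru tu prt kt mF Ft mB.
have mprB : measurable (pr @^-1` B).
  by rewrite -[X in measurable X]setTI; exact: mpr.
have mC : measurable (F `&` [set w | B (pr w)]) by exact: measurableI.
have Ft' w : F (path_trunc j.+1 w) = F w.
  by rewrite -Ft path_trunc_le// Ft.
have Fu w z : F (u (w, z)) = F w by rewrite -Ft tu Ft.
have indE (C : set S) v : measurable C -> (\1_C v)%:E = \d_v C :> \bar R.
  by [].
transitivity (\int[P]_v (\1_(F `&` [set w | B (pr w)]) v)%:E).
  by rewrite integral_indic// setIT.
rewrite (HP j.+1); first last.
- move=> w; rewrite !indicE.
  suff -> : (path_trunc j.+1 w \in F `&` [set w0 | B (pr w0)]) =
            (w \in F `&` [set w0 | B (pr w0)]) by [].
  by apply/idP/idP; rewrite !inE /= Ft' prt.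
- by move=> v; rewrite lee_fin.
- exact/measurable_EFinP/measurable_indic.
have mkB : measurable_fun [set: S] (k ^~ B) by exact: measurable_kernel.
rewrite integral_it_lawS; first last.
- by move=> v; rewrite lee_fin.
- exact/measurable_EFinP/measurable_indic.
have mg : measurable_fun [set: S] (fun w => (\1_F w)%:E * k w B).
  by apply: emeasurable_funM => //; exact/measurable_EFinP/measurable_indic.
transitivity (\int[it_law (point : S) mstep j]_w ((\1_F w)%:E * k w B)).
  apply: eq_integral => w _; rewrite stepE integral_resample//; first last.
  - exact/measurable_EFinP/measurable_indic.
  transitivity (\int[k w]_z ((\1_F w)%:E * (\1_B z)%:E)).
    apply: eq_integral => z _; rewrite -EFinM !indicE; congr (_ %:E).
    rewrite -natrM mulnb; congr (_%:R); congr nat_of_bool.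
    by apply/idP/andP; rewrite !inE /= Fu pru.
  rewrite ge0_integralZl//.
  - by rewrite integral_indic// setIT.
  - exact/measurable_EFinP/measurable_indic.
rewrite -HP//; first last.
- move=> w; rewrite kt; congr (_ * _); rewrite !indicE.
  suff -> : (path_trunc j w \in F) = (w \in F) by [].
  by apply/idP/idP; rewrite !inE Ft.
rewrite [RHS]integral_mkcond; apply: eq_integral => w _.
by rewrite patchE indicE; case: ifP => _; rewrite ?mul1e ?mul0e.
Qed.

Lemma strategic_law_exists : exists P, is_strategic_law P.
Proof.
have [P HP] := law_exists; exists P.
have mst n : measurable_fun [set: S] (fun w : S => (w n).1).
  exact: (measurableT_comp measurable_fst (measurable_coord n)).
have mac n : measurable_fun [set: S] (fun w : S => (w n).2).
  exact: (measurableT_comp measurable_snd (measurable_coord n)).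
have stX n w : step n.*2 w =
    resample (state_kernel n) (measurable_set_state n) w.
  by rewrite /step odd_double doubleK.
have stA n w : step n.*2.+1 w =
    resample (action_kernel n) (measurable_set_action n) w.
  by rewrite /step /= odd_double /= uphalf_double.
split.
- move=> B mB.
  have := @disint P HP 0%N _ X (state_kernel 0%N) _ (measurable_set_state 0%N)
    (fun w => (w 0%N).1) setT B (stX 0%N) (mst 0%N).
  rewrite setTI => ->//.
  by rewrite integral_cst//= /kprobability/= [X in _ * X]probability_setT mule1.
- move=> n F B /state_past_trunc[mF Ft] mB.
  apply: (disint HP (stA n) (mac n)) => //.
  + by move=> w a; rewrite /set_action/= eqxx.
  + by move=> w a; exact: path_trunc_set_action.
  + by move=> w; rewrite /path_trunc/= ltnSn.
  + by move=> w; rewrite /action_kernel/= /kreindex/= ltnSn.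
- move=> n F B /action_past_trunc[mF Ft] mB.
  apply: (disint HP (stX n.+1) (mst n.+1)) => //.
  + by move=> w a; rewrite /set_state/= eqxx.
  + by move=> w a; exact: path_trunc_set_state.
  + by move=> w; rewrite /path_trunc/= ltnSn.
  + move=> w; rewrite /state_kernel /= /kreindex.
    suff -> : path_trunc n.+1.*2 w n = w n by [].
    by rewrite /path_trunc doubleS ltnSn ltnS leqnSn -surjective_pairing.
Qed.

End strategic_law.

Section costs.
Local Open Scope ereal_scope.
Context (dX dA : measure_display) (R : realType).
Context (X : measurableType dX) (A : measurableType dA).
Variable p : R.-pker (X * A) ~> X.

(* The law P^pi_mu of (x_0, a_0, x_1, a_1, ...). On measurable sets it is
   determined by [is_strategic_law] (pi-lambda theorem), so the choice made by
   [cid] is immaterial. *)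
Definition strategic_law (pi : R.-pker X ~> A) (mu : probability X R) :
    probability (traj X A) R :=
  projT1 (cid (strategic_law_exists p pi mu)).

Lemma strategic_lawP (pi : R.-pker X ~> A) (mu : probability X R) :
  is_strategic_law p pi mu (strategic_law pi mu).
Proof. exact: (projT2 (cid (strategic_law_exists p pi mu))). Qed.

Definition expected (pi : R.-pker X ~> A) (mu : probability X R)
    (f : traj X A -> \bar R) : \bar R :=
  \int[strategic_law pi mu]_w f w.

Definition total_cost (c_ : nat -> X * A -> R) (pi : R.-pker X ~> A)
    (mu : probability X R) : \bar R :=
  expected pi mu (fun w => \sum_(0 <= n <oo) (c_ n (w n))%:E).

Definition discounted_cost (beta : R) (c : X * A -> R) (pi : R.-pker X ~> A)
    (mu : probability X R) : \bar R :=
  expected pi mu (fun w => \sum_(0 <= n <oo) (beta ^+ n * c (w n))%:E).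

(* 1/N times the sum over 0 <= n <= N, that is, of N + 1 terms. *)
Definition average_cost (c : X * A -> R) (pi : R.-pker X ~> A)
    (mu : probability X R) : \bar R :=
  limn_esup (fun N : nat => (N%:R^-1)%:E *
    expected pi mu (fun w => \sum_(0 <= n < N.+1) (c (w n))%:E)).

(* Q_pi(B | x) = \int p(B | x, a) pi(da | x) *)
Definition induced_kernel (pi : R.-pker X ~> A) : X -> {measure set X -> \bar R} :=
  mkcomp pi p.

Fixpoint induced_kernel_iter (pi : R.-pker X ~> A) (n : nat) (x : X)
    (B : set X) : \bar R :=
  if n is m.+1 then
    \int[induced_kernel pi x]_y induced_kernel_iter pi m y B
  else \d_x B.

Definition invariant_measure (pi : R.-pker X ~> A) (nu : probability X R) :=
  forall B, measurable B -> \int[nu]_x induced_kernel pi x B = nu B.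

Definition unique_invariant_measure (pi : R.-pker X ~> A)
    (nu : probability X R) :=
  invariant_measure pi nu /\
  forall nu' : probability X R, invariant_measure pi nu' ->
    forall B, measurable B -> nu' B = nu B.

(* The set M_pi, where nu is the invariant probability measure of Q_pi. *)
Definition ergodic_states (c : X * A -> R) (pi : R.-pker X ~> A)
    (nu : probability X R) : set X :=
  [set x | (fun N : nat => (N%:R^-1)%:E *
      \sum_(0 <= n < N) expected pi (dirac x) (fun w => (c (w n))%:E)) @ \oo
    --> \int[nu]_y \int[pi y]_a (c (y, a))%:E].

Definition setwise_cvg (nu_ : nat -> set X -> \bar R) (nu : set X -> \bar R) :=
  forall B, measurable B -> (fun n => nu_ n B) @ \oo --> nu B.

Definition setwise_relatively_seq_compact (G : set (probability X R)) :=
  forall nu_ : nat -> probability X R, (forall n, G (nu_ n)) ->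
  exists (phi : nat -> nat) (nu : probability X R),
    (forall m n, (m < n)%N -> (phi m < phi n)%N) /\
    setwise_cvg (fun n => nu_ (phi n)) nu.

Definition invariant_measures : set (probability X R) :=
  [set nu | exists pi : R.-pker X ~> A, invariant_measure pi nu].

End costs.

Section quantization.
Context (dX dA : measure_display) (R : realType).
Context (X : polishType R dX) (A : polishType R dA).

Definition finite_net (k : nat) (L : set A) :=
  finite_set L /\ forall a, exists2 b, L b & mdist a b < k%:R^-1.

(* f : X x [0,1] -> A; its values outside X x [0,1] are irrelevant. *)
Definition represents (f : X * R -> A) (pi : R.-pker X ~> A) :=
  measurable_fun ([set: X] `*` (`[0, 1] : set R)) f /\
  forall x E, measurable E ->
    pi x E = lebesgue_measure [set z : R | z \in `[0, 1] /\ E (f (x, z))].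

Definition quantizer (f : X * R -> A) (L : set A) (q : X * R -> A) :=
  measurable_fun ([set: X] `*` (`[0, 1] : set R)) q /\
  forall x z, z \in `[0, 1] ->
    L (q (x, z)) /\
    forall b, L b -> mdist (f (x, z)) (q (x, z)) <= mdist (f (x, z)) b.

Definition induced_by_quantizer (q : X * R -> A) (pi : R.-pker X ~> A) :=
  forall x E, measurable E ->
    (pi x E = \int[lebesgue_measure]_(z in `[0%R, 1%R]) \d_(q (x, z)) E)%E.

End quantization.

(* Main.v *)
From HB Require Import structures.
Require Import Defs.
From mathcomp Require Import all_boot all_order all_algebra.
From mathcomp Require Import all_classical all_reals all_analysis.
From mathcomp Require Import measurable_realfun.
From mathcomp Require Import ring.
Import Order.TTheory GRing.Theory Num.Theory.
Import numFieldNormedType.Exports.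
Local Open Scope classical_set_scope.
Local Open Scope ring_scope.
Local Open Scope ereal_scope.

(** Integrate out the actions: the expected cost at stage n is
    [\int mu (iter n Q_pi (T_pi c))], where [T_pi g x] averages [g (x, a)] over
    the actions a drawn at x and [Q_pi] is the one-step transition operator
    ([expected_stage]). So it suffices to follow how the two averaging
    operators depend on the policy.

    Writing [pi] through a function [f (x, z)] of a uniform z turns [T_pi g x]
    into an integral over [0, 1]; the k-th quantizer is within 1/k of f, so
    dominated convergence gives [T_(pi^k) g x --> T_pi g x] for every bounded g
    that is continuous in the action ([quantized_policy_cvg]). The actions
    converge only pointwise in z, so the laws of the actions converge only
    weakly; but p is setwise continuous in the action, so g may be taken to be
    [p (B | x, a)], and the transition kernels of [pi^k] converge setwise to
    that of [pi] at every state ([induced_kernel_cvg]).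

    Setwise convergence of the measures is what makes such limits compose: if
    the measures converge setwise and the uniformly bounded integrands converge
    pointwise, the integrals converge ([setwise_integral_cvg], from a Fatou
    lemma with varying measures). Induction on n then gives the convergence of
    the expected cost of every stage ([expected_stage_cvg]).

    The three costs follow. For the total cost, split the series where the tail
    is uniformly small ([total_cost_cvg]); the discounted cost is the total cost
    of [beta ^ n c], whose tails are dominated by a geometric series. For an
    initial state at which every policy is ergodic, the average cost is
    [\int nu_pi (T_pi c)] ([average_cost_ergodic]), so it remains to see that the
    invariant measures of [pi^k] converge setwise to that of [pi]. Under
    compactness, every subsequence has a setwise convergent further subsequence,
    whose limit is invariant for [pi] and hence equal to [nu_pi]
    ([invariant_cvg_compact]); under uniform ergodicity, the invariant measures
    are approximated, uniformly in k, by n-step transition probabilities, which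
    converge ([invariant_cvg_uniform]). *)
Set Implicit Arguments.
Unset Strict Implicit.
Unset Printing Implicit Defensive.

(** * Limits of sequences *)

Lemma cvg_limn_einf_esup (R : realType) (u : nat -> \bar R) l :
  limn_esup u <= l -> l <= limn_einf u -> u @ \oo --> l.
Proof.
move=> ul lu.
have eq_inf : limn_einf u = l.
  by apply/eqP; rewrite eq_le lu andbT (le_trans _ ul)// limn_einf_sup.
have eq_sup : limn_esup u = l.
  by apply/eqP; rewrite eq_le ul (le_trans lu)// limn_einf_sup.
apply: (@squeeze_cvge _ _ _ _ (einfs u) u (esups u)).
- apply: nearW => n; apply/andP; split.
  + by apply: ereal_inf_lbound; exists n => /=.
  + by apply: ereal_sup_ubound; exists n => /=.
- by rewrite -eq_inf limn_einf_lim; exact: is_cvg_einfs.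
- by rewrite -eq_sup limn_esup_lim; exact: is_cvg_esups.
Qed.

(** An interchange of limits used for the series and for uniform
    ergodicity: [u] may be compared, within any e and uniformly in the index,
    with a convergent sequence. The finiteness conditions on the comparison
    sequence make u and l finite. *)
Lemma cvg_uniform_approx (R : realType) (u : nat -> \bar R) (l : \bar R) :
  (forall e : R, (0 < e)%R -> exists (v : nat -> \bar R) (m : \bar R),
    [/\ m \is a fin_num /\ (forall k, v k \is a fin_num), v @ \oo --> m,
        forall k, `|v k - u k| < e%:E & `|m - l| < e%:E]) ->
  u @ \oo --> l.
Proof.
move=> H.
have fin (x y : \bar R) (e : R) : x \is a fin_num -> `|x - y| < e%:E -> y \is a fin_num.
  by case: x => [x| |]//; case: y.
have [v [m [[mfin vfin] _ vu ml]]] := H 1%R ltr01.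
have lfin := fin _ _ _ mfin ml.
have ufin k : u k \is a fin_num by exact: fin (vfin k) (vu k).
rewrite -(fineK lfin); apply/fine_cvgP; split; first exact: nearW.
apply/cvgrPdist_lt => e e0.
have e3 : (0 < e / 3)%R by rewrite divr_gt0.
have {m mfin v vfin vu ml} [v [m [[mfin vfin] vm vu ml]]] := H _ e3.
move: vm; rewrite -(fineK mfin) => /fine_cvgP[_ /cvgrPdist_lt/(_ _ e3)].
apply: filterS => k; move: ml (vu k).
rewrite -(fineK mfin) -(fineK lfin) -(fineK (vfin k)) -(fineK (ufin k)) /=.
rewrite !lte_fin => ml vku mv.
have -> : (fine l - fine (u k) = (fine l - fine m) + (fine m - fine (v k))
  + (fine (v k) - fine (u k)))%R by rewrite !addrA !subrK.
have -> : (e = e / 3 + e / 3 + e / 3)%R by field.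
rewrite (le_lt_trans (ler_normD _ _))// ltrD//.
by rewrite (le_lt_trans (ler_normD _ _))// ltrD// distrC.
Qed.

Lemma cvg_subsequence (T : topologicalType) (u : nat -> T) (l : T) :
  (forall s : nat -> nat, (forall n, (n <= s n)%N) ->
    exists2 r : nat -> nat, (forall n, (n <= r n)%N) &
      u \o s \o r @ \oo --> l) ->
  u @ \oo --> l.
Proof.
move=> H V lV; apply: contrapT => nV.
have /choice[s sP] : forall n, exists k, (n <= k)%N /\ ~ V (u k).
  move=> n; apply: contrapT => nk; apply: nV; exists n => // k /= le_nk.
  by apply: contrapT => nVk; apply: nk; exists k.
have [r _ /(_ V lV)[n _ /(_ n (leqnn n)) Vn]] := H s (fun n => (sP n).1).
exact: (sP (r n)).2.
Qed.

Lemma cvg_infty_ge (k : nat -> nat) : (forall n, (n <= k n)%N) ->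
  k n @[n --> \oo] --> \oo.
Proof.
move=> nk V [N _ NV]; exists N => // n /= Nn; apply: NV => /=.
exact: leq_trans Nn (nk n).
Qed.

(** * Integrals under setwise convergence of measures *)

Section setwise.
Context d (T : measurableType d) (R : realType).
Variables (nu_ : nat -> {measure set T -> \bar R}) (nu : {measure set T -> \bar R}).
Hypothesis nu_nu : setwise_cvg nu_ nu.

Import HBNNSimple.

Lemma setwise_sintegral_cvg (s : {nnsfun T >-> R}) :
  sintegral (nu_ n) s @[n --> \oo] --> sintegral nu s.
Proof.
rewrite sintegralE fsbig_finite//=.
under eq_fun do rewrite sintegralE fsbig_finite//=.
apply: cvg_nnesum => [r _|r _].
- by apply: nearW => n; exact: nnsfun_mulemu_ge0.
- by apply: cvgeZl => //; exact: nu_nu.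
Qed.

Variables (h_ : nat -> T -> \bar R) (h : T -> \bar R).
Hypothesis mh_ : forall n, measurable_fun [set: T] (h_ n).
Hypothesis h_ge0 : forall n x, 0 <= h_ n x.
Hypothesis h_h : forall x, h_ ^~ x @ \oo --> h x.

(** Every simple function below [inf_(n >= j) h_ n] is below [h_ n] for n >= j,
    and its integral passes to the setwise limit; then let j grow, by monotone
    convergence. *)
Lemma setwise_fatou :
  \int[nu]_x h x <= limn_einf (fun n => \int[nu_ n]_x h_ n x).
Proof.
pose g j x := einfs (h_ ^~ x) j.
have mg j : measurable_fun [set: T] (g j) by exact: measurable_fun_einfs.
have g0 j x : 0 <= g j x.
  by apply: le_ereal_inf_tmp => _ [m /= _ <-]; exact: h_ge0.
have gh j n x : (j <= n)%N -> g j x <= h_ n x.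
  by move=> jn; apply: ereal_inf_lbound; exists n.
have ndg x : {homo g ^~ x : m n / (m <= n)%N >-> m <= n}.
  exact: nondecreasing_einfs.
have -> : \int[nu]_x h x = \int[nu]_x limn (g ^~ x).
  apply: eq_integral => x _; apply/esym/cvg_lim => //.
  exact: cvg_einfs.
rewrite monotone_convergence//; apply: lime_le.
  apply: ereal_nondecreasing_is_cvgn => m n mn.
  by apply: ge0_le_integral => // x _; exact: ndg.
apply: nearW => j; rewrite ge0_integralTE//.
apply: ge_ereal_sup => _ /= [s sg <-].
rewrite limn_einf_lim.
have <- := cvg_lim (@ereal_hausdorff R) (cvg_einfs (@setwise_sintegral_cvg s)).
apply: lee_lim; [exact: is_cvg_einfs|exact: is_cvg_einfs|].
exists j => // k /= jk; apply: le_ereal_inf_tmp => _ [n /= kn <-].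
apply: (@le_trans _ _ (sintegral (nu_ n) s)).
  by apply: ereal_inf_lbound; exists n.
rewrite -integralT_nnsfun; apply: ge0_le_integral => //.
- by move=> x _; rewrite lee_fin.
- exact/measurable_EFinP.
- by move=> x _; exact: le_trans (sg x) (gh _ _ _ (leq_trans jk kn)).
Qed.

End setwise.

Lemma setwise_integral_cvg d (T : measurableType d) (R : realType)
  (nu_ : nat -> {measure set T -> \bar R}) (nu : {measure set T -> \bar R})
  (h_ : nat -> T -> \bar R) (h : T -> \bar R) (M : R) :
  setwise_cvg nu_ nu -> (forall n, nu_ n setT = 1) -> nu setT = 1 ->
  (forall n, measurable_fun [set: T] (h_ n)) ->
  (forall n x, 0 <= h_ n x <= M%:E) ->
  (forall x, h_ ^~ x @ \oo --> h x) ->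
  \int[nu_ n]_x h_ n x @[n --> \oo] --> \int[nu]_x h x.
Proof.
move=> nu_nu nu_1 nu1 mh_ hM h_h.
have h0 n x : 0 <= h_ n x by have /andP[] := hM n x.
have leM n x : h_ n x <= M%:E by have /andP[] := hM n x.
have hfin n x : h_ n x \is a fin_num.
  by rewrite ge0_fin_numE// (le_lt_trans (leM n x))// ltry.
have limM x : 0 <= h x <= M%:E.
  have -> : h x = limn (h_ ^~ x) by apply/esym/cvg_lim => //; exact: h_h.
  by apply/andP; split; [apply: lime_ge|apply: lime_le];
    try exact: nearW; apply/cvg_ex; exists (h x); exact: h_h.
have mh : measurable_fun [set: T] h.
  by apply: (emeasurable_fun_cvg h_) => // x _; exact: h_h.
have compl (m : {measure set T -> \bar R}) f : m setT = 1 ->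
    measurable_fun [set: T] f -> (forall x, 0 <= f x <= M%:E) ->
    \int[m]_x f x \is a fin_num /\
    \int[m]_x (M%:E - f x) = M%:E - \int[m]_x f x.
  move=> m1 mf fM.
  have f0 x : 0 <= f x by have /andP[] := fM x.
  have fleM x : f x <= M%:E by have /andP[] := fM x.
  have ffin x : f x \is a fin_num.
    by rewrite ge0_fin_numE// (le_lt_trans (fleM x))// ltry.
  have cM : \int[m]_x (cst M%:E x) = M%:E.
    by rewrite integral_cst//= m1 mule1.
  have fin : \int[m]_x f x \is a fin_num.
    rewrite ge0_fin_numE ?integral_ge0//.
    apply: (@le_lt_trans _ _ (\int[m]_x (cst M%:E x))); last by rewrite cM ltry.
    exact: ge0_le_integral.
  have mMf : measurable_fun [set: T] (fun x => M%:E - f x).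
    exact: (emeasurable_funB (measurable_cst M%:E) mf).
  split => //; apply/eqP; rewrite eq_sym -[X in X - _ == _]cM.
  rewrite sube_eq ?cM// ?fin_num_adde_defl//; apply/eqP.
  rewrite -ge0_integralD//; last by move=> x _; rewrite subre_ge0.
  by rewrite -[LHS]cM; apply: eq_integral => x _; rewrite /= subeK.
(* Fatou for [h_ n] and for [M - h_ n]: the masses being 1, the second one bounds
   the limit superior of the integrals of [h_ n]. *)
pose u n := \int[nu_ n]_x h_ n x.
have le1 : \int[nu]_x h x <= limn_einf u by exact: setwise_fatou.
have le2 : M%:E - \int[nu]_x h x <= M%:E - limn_esup u.
  rewrite -limn_einfN -limn_einf_shift//.
  rewrite -(compl _ _ nu1 mh limM).2.
  under [X in _ <= limn_einf X]eq_fun do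
    rewrite /= -(compl _ _ (nu_1 _) (mh_ _) (hM _)).2.
  apply: setwise_fatou => //.
  - by move=> n; exact: (emeasurable_funB (measurable_cst M%:E) (mh_ n)).
  - by move=> n x; rewrite subre_ge0.
  - by move=> x; apply: cvgeB => //; exact: cvg_cst.
apply: cvg_limn_einf_esup le1.
by move: le2; rewrite leeD2lE// leeN2.
Qed.

(** * Expected costs as iterates of the transition operator *)

Section mixture.
Context d (Z : measurableType d) d' (Y : measurableType d') (R : realType).
Variables (P : probability Z R) (k : R.-pker Z ~> Y).
Variable m : {measure set Y -> \bar R}.

(** The measure [B |-> \int P(dz) k z B], as a composition of kernels that starts
    from a one-point space. *)
Let mixture : {measure set Y -> \bar R} :=
  mkcomp (kprobability (measurable_cst (P : pprobability Z R)) : R.-pker unit ~> Z)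
    (kreindex k (measurable_snd : measurable_fun setT (@snd unit Z))) tt.

Lemma integral_mixture (f : Y -> \bar R) :
  (forall B, measurable B -> m B = \int[P]_z k z B) ->
  measurable_fun [set: Y] f -> (forall y, 0 <= f y) ->
  \int[m]_y f y = \int[P]_z \int[k z]_y f y.
Proof.
move=> mE mf f0; rewrite (eq_measure_integral mixture); last by move=> B mB _; exact: mE.
exact: integral_kcomp.
Qed.

(** Agreement on a pi-system suffices: the law of the process prescribes the joint
    law of a state and its action on rectangles only. *)
Lemma mixture_unique (G : set (set Y)) :
  measurable = <<s G >> -> setI_closed G -> G setT ->
  (forall B, G B -> m B = \int[P]_z k z B) -> m setT < +oo ->
  forall B, measurable B -> m B = \int[P]_z k z B.
Proof.
move=> YG GI GT mE moo B mB.
apply: (measure_unique G (fun=> setT) YG GI (fun=> GT) _ m mixture) => //.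
exact: bigcup_const.
Qed.

End mixture.

Section graph_kernel.
Context d (X : measurableType d) d' (A : measurableType d') (R : realType).
Variable k : R.-pker X ~> A.

(** The law of (x, a) for a drawn from [k x]. *)
Definition graph_kernel : X -> {measure set (X * A) -> \bar R} :=
  mkcomp k (kdirac (@measurable_id _ (X * A)%type setT)).

Lemma integral_graph_kernel x f : measurable_fun [set: X * A] f ->
  (forall y, 0 <= f y) -> \int[graph_kernel x]_y f y = \int[k x]_a f (x, a).
Proof.
move=> mf f0; rewrite [LHS](integral_kcomp k (kdirac (@measurable_id _ _ setT)))//.
apply: eq_integral => a _.
by rewrite integral_dirac// diracT mul1e.
Qed.

Let measurable_graph_kernel U : measurable U ->
  measurable_fun [set: X] (graph_kernel ^~ U).
Proof. exact: (measurable_kernel (mkcomp k (kdirac _))). Qed.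

HB.instance Definition _ :=
  isKernel.Build _ _ _ _ _ graph_kernel measurable_graph_kernel.

Let graph_kernel1 x : graph_kernel x setT = 1.
Proof.
rewrite -[LHS]mul1e -integral_cst// integral_graph_kernel//.
by rewrite integral_cst// mul1e prob_kernel.
Qed.

HB.instance Definition _ :=
  Kernel_isProbability.Build _ _ _ _ _ graph_kernel graph_kernel1.

End graph_kernel.

Section mdp.
Context (dX dA : measure_display) (R : realType).
Context (X : measurableType dX) (A : measurableType dA).
Variable p : R.-pker (X * A) ~> X.
Implicit Types (pi : R.-pker X ~> A) (mu : probability X R).

Definition action_mean pi (g : X * A -> \bar R) (x : X) : \bar R :=
  \int[pi x]_a g (x, a).

Definition next_mean (h : X -> \bar R) (y : X * A) : \bar R := \int[p y]_x h x.

(** Its iterates send indicators to the n-step transition probabilities, and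
    action-averaged costs to the expected costs of the later stages. *)
Definition transition pi (h : X -> \bar R) (x : X) : \bar R :=
  \int[induced_kernel p pi x]_y h y.

Lemma measurable_action_mean pi g : measurable_fun [set: X * A] g ->
  (forall y, 0 <= g y) -> measurable_fun [set: X] (action_mean pi g).
Proof. by move=> mg g0; exact: measurable_fun_integral_finite_kernel. Qed.

Lemma measurable_next_mean h : measurable_fun [set: X] h ->
  (forall x, 0 <= h x) -> measurable_fun [set: X * A] (next_mean h).
Proof.
move=> mh h0; apply: measurable_fun_integral_kernel => //.
exact: measurable_kernel.
Qed.

Lemma transitionE pi h : measurable_fun [set: X] h -> (forall x, 0 <= h x) ->
  transition pi h = action_mean pi (next_mean h).
Proof. by move=> mh h0; apply/funext => x; exact: integral_kcomp. Qed.

Lemma mean_bounds d (T : measurableType d) (m : {measure set T -> \bar R})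
    (f : T -> \bar R) (M : R) : m setT = 1 -> measurable_fun [set: T] f ->
  (forall x, 0 <= f x <= M%:E) -> 0 <= \int[m]_x f x <= M%:E.
Proof.
move=> m1 mf fM; rewrite integral_ge0/=; last by move=> x _; have /andP[] := fM x.
rewrite -[leRHS]mule1 -[in leRHS]m1 -integral_cst//.
by apply: ge0_le_integral => // x _; have /andP[] := fM x.
Qed.

Lemma induced_kernelT pi x : induced_kernel p pi x setT = 1.
Proof.
rewrite /induced_kernel/= /kcomp; under eq_integral do rewrite prob_kernel.
by rewrite integral_cst//= prob_kernel mule1.
Qed.

Lemma measurable_transition pi h : measurable_fun [set: X] h ->
  (forall x, 0 <= h x) -> measurable_fun [set: X] (transition pi h).
Proof.
move=> mh h0; rewrite transitionE//; apply: measurable_action_mean.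
  exact: measurable_next_mean.
by move=> y; exact: integral_ge0.
Qed.

Lemma action_mean_bounds pi g (M : R) x :
  measurable_fun [set: X * A] g -> (forall y, 0 <= g y <= M%:E) ->
  0 <= action_mean pi g x <= M%:E.
Proof.
move=> mg gM; apply: mean_bounds => //; first exact: prob_kernel.
exact: measurableT_comp.
Qed.

Lemma iter_transition_bounds pi n h (M : R) : measurable_fun [set: X] h ->
  (forall x, 0 <= h x <= M%:E) ->
  measurable_fun [set: X] (iter n (transition pi) h) /\
  forall x, 0 <= iter n (transition pi) h x <= M%:E.
Proof.
move=> mh hM; elim: n => [//|n [mi iM]] /=; split.
  by apply: measurable_transition => // x; have /andP[] := iM x.
by move=> x; apply: mean_bounds => //; exact: induced_kernelT.
Qed.

Section law.
Variables (pi : R.-pker X ~> A) (mu : probability X R).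
Let P := strategic_law p pi mu.

Let mstate n : measurable_fun [set: traj X A] (fun w : traj X A => (w n).1).
Proof. exact: (measurableT_comp measurable_fst (measurable_coord n)). Qed.

Lemma expected_initial h : measurable_fun [set: X] h -> (forall x, 0 <= h x) ->
  expected p pi mu (fun w => h (w 0%N).1) = \int[mu]_x h x.
Proof.
move=> mh h0; have [init _ _] := strategic_lawP p pi mu.
transitivity (\int[pushforward P (fun w : traj X A => (w 0%N).1)]_x h x).
  by rewrite ge0_integral_pushforward// preimage_setT.
by apply: eq_measure_integral => B mB _; exact: init.
Qed.

Lemma expected_next n h : measurable_fun [set: X] h -> (forall x, 0 <= h x) ->
  expected p pi mu (fun w => h (w n.+1).1) =
  expected p pi mu (fun w => next_mean h (w n)).
Proof.
move=> mh h0; have [_ _ next] := strategic_lawP p pi mu.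
transitivity (\int[pushforward P (fun w : traj X A => (w n.+1).1)]_x h x).
  by rewrite ge0_integral_pushforward// preimage_setT.
apply: (@integral_mixture _ _ _ _ _ P (kreindex p (measurable_coord n))) => //.
move=> B mB; have := next n setT B _ mB; rewrite setTI; apply.
rewrite -(setD0 setT); apply: sigma_algebraCD; exact: sigma_algebra0.
Qed.

(** Given x_n, the action a_n has law [pi x_n]. The definition of the law of the
    process says so for events {x_n in C, a_n in B} only; rectangles determine
    the joint law of x_n and a_n. *)
Lemma expected_action n g : measurable_fun [set: X * A] g ->
  (forall y, 0 <= g y) ->
  expected p pi mu (fun w => g (w n)) =
  expected p pi mu (fun w => action_mean pi g (w n).1).
Proof.
move=> mg g0; have [_ act _] := strategic_lawP p pi mu.
have mn := @measurable_coord _ _ X A n.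
(* The pushforward is a measure given the measurability of the coordinate, so
   [law_of] is a function of that proof. *)
pose law_of : {measure set (X * A) -> \bar R} := pushforward P (fun w : traj X A => w n).
pose m := law_of mn.
transitivity (\int[m]_y g y).
  by rewrite ge0_integral_pushforward.
pose k : R.-pker traj X A ~> (X * A)%type :=
  kreindex (graph_kernel pi) (mstate n).
transitivity (\int[P]_w \int[k w]_y g y); last first.
  by apply: eq_integral => w _; exact: integral_graph_kernel.
apply: integral_mixture => //.
pose G := [set C `*` B | C in @measurable _ X & B in @measurable _ A].
apply: (@mixture_unique _ _ _ _ _ P k m G).
- exact: measurable_prod_measurableType.
- move=> _ _ [C mC [B mB <-]] [C' mC' [B' mB' <-]]; rewrite -setXI.
  by exists (C `&` C'); [exact: measurableI|exists (B `&` B') => //; exact: measurableI].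
- by exists setT => //; exists setT => //; rewrite setXTT.
- move=> _ [C mC [B mB <-]].
  have mCn : measurable [set w : traj X A | C (w n).1].
    by rewrite -[X in measurable X]setTI; exact: mstate.
  have sC : state_past (X := X) (A := A) n [set w | C (w n).1].
    by apply: sub_sigma_algebra; left; exists n => //=; exists C.
  rewrite [LHS](act n _ _ sC mB) integral_mkcond; apply: eq_integral => w _.
  have mCB : measurable (C `*` B) by exact: measurableX.
  transitivity (\int[k w]_y (\1_(C `*` B) y)%:E); last first.
    by rewrite integral_indic// setIT.
  rewrite [RHS]integral_graph_kernel//; last first.
    exact/measurable_EFinP/measurable_indic.
  rewrite patchE; case: ifPn => Cw.
  + transitivity (\int[pi (w n).1]_a (\1_B a)%:E).
      by rewrite integral_indic// setIT.
    apply: eq_integral => a _; congr _%:E; rewrite !indicE.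
    congr (_%:R); congr nat_of_bool.
    by apply/idP/idP; rewrite !inE => //; [split=> //; rewrite inE in Cw|case].
  + rewrite integral0_eq// => a _; rewrite indicE memNset// => -[Cwn _].
    by move/negP: Cw; apply; rewrite inE.
- by rewrite [ltLHS]probability_setT ltry.
Qed.

Lemma expected_state n h : measurable_fun [set: X] h -> (forall x, 0 <= h x) ->
  expected p pi mu (fun w => h (w n).1) =
  \int[mu]_x iter n (transition pi) h x.
Proof.
elim: n h => [|n IH] h mh h0; first exact: expected_initial.
rewrite expected_next// expected_action; first last.
- by move=> y; exact: integral_ge0.
- exact: measurable_next_mean.
rewrite -transitionE// IH; first by rewrite iterSr.
- exact: measurable_transition.
- by move=> x; exact: integral_ge0.
Qed.

(** In this form the expected cost depends on the policy only through the two
    averaging operators, and on the initial law only through its values on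
    measurable sets. *)
Lemma expected_stage n g : measurable_fun [set: X * A] g ->
  (forall y, 0 <= g y) ->
  expected p pi mu (fun w => g (w n)) =
  \int[mu]_x iter n (transition pi) (action_mean pi g) x.
Proof.
move=> mg g0; rewrite expected_action// expected_state//.
- exact: measurable_action_mean.
- by move=> x; exact: integral_ge0.
Qed.

End law.

Lemma expected_bounds pi mu n (c : X * A -> R) (M : R) :
  measurable_fun [set: X * A] c -> (forall y, (0 <= c y <= M)%R) ->
  0 <= expected p pi mu (fun w => (c (w n))%:E) <= M%:E.
Proof.
move=> mc cM; apply: mean_bounds; first exact: probability_setT.
  apply/measurable_EFinP; apply: (measurableT_comp mc); exact: measurable_coord.
by move=> w; rewrite !lee_fin.
Qed.

Lemma induced_kernel_iterE pi n x B :
  induced_kernel_iter p pi n x B =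
  iter n (transition pi) (fun y => \d_y B) x.
Proof.
elim: n x => [//|n IH] x /=.
by apply: eq_integral => y _; exact: IH.
Qed.

Lemma total_cost_series (c_ : nat -> X * A -> R) pi mu :
  (forall n, measurable_fun [set: X * A] (c_ n)) ->
  (forall n y, (0 <= c_ n y)%R) ->
  total_cost p c_ pi mu =
  \sum_(0 <= n <oo) expected p pi mu (fun w => (c_ n (w n))%:E).
Proof.
move=> mc c0; rewrite /total_cost /expected integral_nneseries//.
- move=> n; apply/measurable_EFinP.
  by apply: (measurableT_comp (mc n)); exact: measurable_coord.
- by move=> n w _; rewrite lee_fin.
Qed.

Lemma measurable_induced_kernel pi B : measurable B ->
  measurable_fun [set: X] (fun x => induced_kernel p pi x B).
Proof. exact: (measurable_kernel (mkcomp pi p)). Qed.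

Lemma induced_kernel_bounds pi x B : measurable B ->
  0 <= induced_kernel p pi x B <= 1.
Proof.
move=> mB; rewrite measure_ge0/= -(induced_kernelT pi x).
by rewrite le_measure// inE.
Qed.

(** The average cost has one term more than the Cesaro mean of the ergodic
    property; bounded costs make its contribution vanish. *)
Lemma average_cost_ergodic (c : X * A -> R) (M : R) pi mu (nu : probability X R) x :
  measurable_fun [set: X * A] c -> (forall y, (0 <= c y <= M)%R) ->
  ergodic_states p c pi nu x -> (forall B, measurable B -> mu B = \d_x B) ->
  average_cost p c pi mu =
  \int[nu]_y action_mean pi (fun y => (c y)%:E) y.
Proof.
move=> mc cM erg mux.
have mc' : measurable_fun [set: X * A] (fun y => (c y)%:E) by exact/measurable_EFinP.
have c0 y : 0 <= (c y)%:E by have /andP[? _] := cM y; rewrite lee_fin.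
pose E n := expected p pi mu (fun w => (c (w n))%:E).
have Ex n : expected p pi (dirac x) (fun w => (c (w n))%:E) = E n.
  transitivity (\int[dirac x : probability X R]_y
    iter n (transition pi) (action_mean pi (fun y => (c y)%:E)) y).
    exact: (expected_stage pi _ n mc' c0).
  rewrite /E (expected_stage pi mu n mc' c0).
  by apply: eq_measure_integral => B mB _; exact/esym/mux.
have E0 n : 0 <= E n by have /andP[] := expected_bounds pi mu n mc cM.
have EM n : E n <= M%:E by have /andP[] := expected_bounds pi mu n mc cM.
have sumE N : expected p pi mu (fun w => \sum_(0 <= n < N) (c (w n))%:E) =
    \sum_(0 <= n < N) E n.
  rewrite /expected ge0_integral_sum//.
  by move=> n; apply: (measurableT_comp mc'); exact: measurable_coord.
have erg' : (fun N : nat => (N%:R^-1)%:E * \sum_(0 <= n < N) E n) @ \oo -->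
    \int[nu]_y action_mean pi (fun y => (c y)%:E) y.
  by move: erg; rewrite /ergodic_states/=; under eq_fun do under eq_bigr do rewrite Ex.
have inv0 : (N%:R^-1 : R)%R @[N --> \oo] --> 0%R.
  rewrite -cvg_shiftS; exact: cvg_harmonic.
have last0 : (N%:R^-1)%:E * E N @[N --> \oo] --> 0.
  apply: (@squeeze_cvge _ _ _ _ (cst 0) _ (fun N => (N%:R^-1 * M)%:E)).
  - apply: nearW => N; rewrite mule_ge0//= ?lee_fin ?invr_ge0//.
    by rewrite EFinM lee_wpmul2l// lee_fin invr_ge0.
  - exact: cvg_cst.
  - apply: cvg_EFin; first exact: nearW.
    by rewrite -[0%R](mul0r M); apply: cvgM => //; exact: cvg_cst.
apply: (cvg_limn_einf_sup _).2.
rewrite (_ : (fun N : nat => _) =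
  (fun N : nat => (N%:R^-1)%:E * \sum_(0 <= n < N) E n + (N%:R^-1)%:E * E N)).
  by rewrite -[X in _ --> X]adde0; apply: cvgeD => //; exact: fin_num_adde_defl.
apply/funext => N; rewrite sumE big_nat_recr//= ge0_muleDr//.
exact: sume_ge0.
Qed.

(** The tails are dominated by those of [M beta ^ n], whatever the policy. *)
Lemma discounted_tail (beta : R) (c : X * A -> R) (M : R) mu (e : R) :
  measurable_fun [set: X * A] c -> (forall y, (0 <= c y <= M)%R) ->
  (0 < beta < 1)%R -> (0 < e)%R ->
  exists N, forall pi,
    \sum_(N <= n <oo) expected p pi mu (fun w => (beta ^+ n * c (w n))%:E) < e%:E.
Proof.
move=> mc cM /andP[b0 b1] e0.
have M0 : (0 <= M)%R by have /andP[] := cM point; exact: le_trans.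
have bn0 n : (0 <= beta ^+ n)%R by rewrite exprn_ge0// ltW.
pose t n : \bar R := (beta ^+ n * M)%:E.
have t0 n : 0 <= t n by rewrite lee_fin mulr_ge0.
have sumt : \sum_(0 <= n <oo) t n < +oo.
  have : (fun n => \sum_(0 <= k < n) t k) @ \oo --> (M / (1 - beta))%:E.
    rewrite (_ : (fun n => _) = EFin \o series (geometric M beta)); last first.
      apply/funext => n /=; rewrite /series/= -sumEFin; apply: eq_bigr => k _.
      by rewrite /t mulrC.
    apply: cvg_EFin; first exact: nearW.
    by apply: cvg_geometric_series; rewrite ger0_norm// ltW.
  by move=> /cvg_lim ->//; exact: ltry.
have /fine_cvgP[tfin /cvgrPdist_lt/(_ e e0) tlt] :=
  nneseries_tail_cvg sumt (fun n _ => t0 n).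
have [N _ /(_ N (leqnn N))[/= tNfin tN]] := filterI tfin tlt.
exists N => pi; apply: (@le_lt_trans _ _ (\sum_(N <= n <oo) t n)).
  apply: lee_nneseries => [n _ _|n _].
    apply: integral_ge0 => w _; rewrite lee_fin mulr_ge0//.
    by have /andP[] := cM (w n).
  have mcn : measurable_fun [set: X * A] (fun y => beta ^+ n * c y)%R.
    by apply: measurable_funM.
  have bounds y : (0 <= beta ^+ n * c y <= beta ^+ n * M)%R.
    by have /andP[? ?] := cM y; rewrite mulr_ge0//= ler_wpM2l.
  by have /andP[] := expected_bounds pi mu n mcn bounds.
rewrite -(fineK tNfin) lte_fin; apply: le_lt_trans tN.
by rewrite sub0r normrN ler_norm.
Qed.

End mdp.

(** * Quantized policies converge *)

Section unit_interval.
Context d (A : measurableType d) (R : realType).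
Let I : set R := `[0%R, 1%R].

Lemma integral_unit_interval_law (m : {measure set A -> \bar R}) (phi : R -> A)
    (g : A -> \bar R) :
  measurable_fun I phi ->
  (forall E, measurable E -> m E = lebesgue_measure (I `&` phi @^-1` E)) ->
  measurable_fun [set: A] g -> (forall a, 0 <= g a) ->
  \int[m]_a g a = \int[lebesgue_measure]_(z in I) g (phi z).
Proof.
move=> mphi mE mg g0.
have mI : measurable I by exact: measurable_itv.
(* [phi] is measurable on the interval only; it is extended by a constant, which
   the uniform law does not see. *)
pose psi : R -> A := phi \_ I.
have psiI z : I z -> psi z = phi z by move=> Iz; rewrite /psi patchE mem_set.
have mpsi : measurable_fun [set: R] psi by apply/(measurable_restrictT phi mI).
pose U := uniform_prob (@ltr01 R).
have intU f : measurable_fun [set: R] f -> (forall z, 0 <= f z) ->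
    \int[U]_z f z = \int[lebesgue_measure]_(z in I) f z.
  by move=> mf f0; rewrite integral_uniform// subr0 invr1 mul1e.
transitivity (\int[pushforward U psi]_a g a).
  apply: eq_measure_integral => E mE' _; rewrite mE//.
  have mpE : measurable (psi @^-1` E).
    by rewrite -[X in measurable X]setTI; exact: mpsi.
  transitivity (\int[U]_z (\1_(psi @^-1` E) z)%:E); last first.
    by rewrite integral_indic// setIT.
  rewrite intU//; last exact/measurable_EFinP/measurable_indic.
  rewrite integral_indic//; congr lebesgue_measure.
  by apply/seteqP; split=> z [] /=; [move=> Iz Ez|move=> Ez Iz]; split=> //;
    move: Ez; rewrite psiI.
rewrite ge0_integral_pushforward// preimage_setT intU//.
- by apply: eq_integral => z /[!inE] Iz /=; rewrite psiI.
- exact: measurableT_comp.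
- by move=> z; exact: g0.
Qed.

End unit_interval.

Section action_continuity.
Context (dX dA : measure_display) (R : realType).
Context (X : polishType R dX) (A : polishType R dA).

Definition seq_continuous_action (g : X * A -> \bar R) :=
  forall x (a_ : nat -> A) (a : A),
    a_ @ \oo --> a -> g (x, a_ n) @[n --> \oo] --> g (x, a).

Lemma seq_continuous_EFin (c : X * A -> R) :
  (forall x, continuous (fun a : A => c (x, a))) ->
  seq_continuous_action (fun y => (c y)%:E).
Proof.
move=> cc x a_ a aa; apply: cvg_EFin; first exact: nearW.
exact: (continuous_cvg _ (cc x a) aa).
Qed.

(** Weak convergence of the laws of the action, state by state, tested on
    functions measurable in the state. *)
Definition policy_cvg (pi_ : nat -> R.-pker X ~> A) (pi : R.-pker X ~> A) :=
  forall (g : X * A -> \bar R) (M : R) x,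
    measurable_fun [set: X * A] g -> (forall y, 0 <= g y <= M%:E) ->
    seq_continuous_action g ->
    action_mean (pi_ k) g x @[k --> \oo] --> action_mean pi g x.

End action_continuity.

Section quantized.
Context (dX dA : measure_display) (R : realType).
Context (X : polishType R dX) (A : polishType R dA).
Variables (pi : R.-pker X ~> A) (pi_ : nat -> R.-pker X ~> A).
Variables (L : nat -> set A) (f : X * R -> A) (q : nat -> X * R -> A).
Hypothesis L_net : forall k, (0 < k)%N -> finite_net k (L k).
Hypothesis f_pi : represents f pi.
Hypothesis q_quantizer : forall k, (0 < k)%N -> quantizer f (L k) (q k).
Hypothesis pi_q : forall k, (0 < k)%N -> induced_by_quantizer (q k) (pi_ k).
Let I : set R := `[0%R, 1%R].

Lemma quantizer_cvg x z : z \in `[0%R, 1%R] -> q k.+1 (x, z) @[k --> \oo] --> f (x, z).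
Proof.
move=> Iz; apply/cvg_ballP => e e0.
have := near_infty_natSinv_lt (PosNum e0); apply: filterS => k ke.
have [_ /(_ (f (x, z)))[b Lb fb]] := L_net (ltn0Sn k).
have [_ /(_ x z Iz)[_ /(_ b Lb) fq]] := q_quantizer (ltn0Sn k).
by rewrite ballEmdist/=; exact: le_lt_trans fq (lt_trans fb ke).
Qed.

Let measurable_slice (h : X * R -> A) x :
  measurable_fun ([set: X] `*` I) h -> measurable_fun I (fun z => h (x, z)).
Proof.
move=> mh; apply: (@measurable_comp _ _ _ _ _ _ ([set: X] `*` I) h) => //.
- by apply: measurableX => //; exact: measurable_itv.
- by move=> _ [z Iz <-].
- exact: measurable_funTS.
Qed.

Lemma action_mean_represented g x : measurable_fun [set: X * A] g ->
  (forall y, 0 <= g y) ->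
  action_mean pi g x = \int[lebesgue_measure]_(z in I) g (x, f (x, z)).
Proof.
move=> mg g0; have [mf piE] := f_pi.
apply: (@integral_unit_interval_law _ _ _ _ (fun z => f (x, z))
  (fun a => g (x, a))) => //.
- exact: measurable_slice.
- by move=> E mE; exact: piE.
- exact: measurableT_comp.
Qed.

Lemma action_mean_quantized k g x : (0 < k)%N -> measurable_fun [set: X * A] g ->
  (forall y, 0 <= g y) ->
  action_mean (pi_ k) g x = \int[lebesgue_measure]_(z in I) g (x, q k (x, z)).
Proof.
move=> k0 mg g0; have [mq _] := q_quantizer k0.
have mqx := measurable_slice x mq.
have mI : measurable I by exact: measurable_itv.
apply: (@integral_unit_interval_law _ _ _ _ (fun z => q k (x, z))
  (fun a => g (x, a))) => //.
- move=> E mE; rewrite (pi_q k0)//.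
  have mIE : measurable (I `&` (fun z => q k (x, z)) @^-1` E) by exact: mqx.
  transitivity (\int[lebesgue_measure]_(z in I)
    (\1_(I `&` (fun z => q k (x, z)) @^-1` E) z)%:E).
    apply: eq_integral => z /[!inE] Iz; rewrite /dirac/= !indicE; congr (_%:R%:E).
    by congr nat_of_bool; apply/idP/idP; rewrite !inE => //; case.
  by rewrite integral_indic// -setIA (setIC _ I) setIA setIid.
- exact: measurableT_comp.
Qed.

Lemma quantized_policy_cvg : policy_cvg pi_ pi.
Proof.
move=> g M x mg gM cg.
have g0 y : 0 <= g y by have /andP[] := gM y.
have mI : measurable I by exact: measurable_itv.
have mgx : measurable_fun [set: A] (fun a => g (x, a)) by exact: measurableT_comp.
(* The quantizers are constrained from index 1 on, hence the shift. *)
rewrite -cvg_shiftS action_mean_represented//=.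
rewrite [X in X @ _](_ : _ = fun k =>
    \int[lebesgue_measure]_(z in I) g (x, q k.+1 (x, z))); last first.
  by apply/funext => k; exact: action_mean_quantized.
apply: (@dominated_cvg _ _ _ lebesgue_measure _ mI
  (fun k z => g (x, q k.+1 (x, z))) (fun z => g (x, f (x, z))) (cst M%:E)).
- move=> k; have [mq _] := q_quantizer (ltn0Sn k).
  exact: (measurableT_comp mgx (measurable_slice x mq)).
- by move=> z Iz; apply: cg; exact: quantizer_cvg.
- by [].
- have Ioo : lebesgue_measure I < +oo.
    by rewrite /I lebesgue_measure_itv/= lte_fin ltr01 sube0 ltry.
  apply/integrableP; split; first exact: measurable_cst.
  rewrite [X in X < _](_ : _ = \int[lebesgue_measure]_(z in I) cst `|M%:E| z)//.
  by rewrite integral_cst// lte_mul_pinfty// abse_ge0.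
- by move=> k z _; have /andP[? ?] := gM (x, q k.+1 (x, z)); rewrite gee0_abs.
Qed.

End quantized.

(** * Convergence of the costs along a convergent sequence of policies *)

Section policy_convergence.
Context (dX dA : measure_display) (R : realType).
Context (X : polishType R dX) (A : polishType R dA).
Variables (p : R.-pker (X * A) ~> X).
Variables (pi : R.-pker X ~> A) (pi_ : nat -> R.-pker X ~> A).
Hypothesis p_cont : forall (x : X) (a_ : nat -> A) (a : A),
  a_ @ \oo --> a -> setwise_cvg (fun n => p (x, a_ n)) (p (x, a)).
Hypothesis pi_pi : policy_cvg pi_ pi.

(** [p (B | x, a)] is a continuous bounded function of the action, so weak
    convergence of the actions becomes setwise convergence of the next states. *)
Lemma induced_kernel_cvg x :
  setwise_cvg (fun k => induced_kernel p (pi_ k) x) (induced_kernel p pi x).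
Proof.
move=> B mB; have := @pi_pi (fun y => p y B) 1%R x; apply.
- exact: measurable_kernel.
- by move=> y; rewrite measure_ge0/= -(prob_kernel y (s := p)) le_measure// inE.
- by move=> x' a_ a aa; exact: p_cont.
Qed.

(** The functions vary with k because the costs are averaged over the actions of
    the k-th policy before being transported. *)
Lemma iter_transition_cvg n (h_ : nat -> X -> \bar R) (h : X -> \bar R) (M : R) :
  (forall k, measurable_fun [set: X] (h_ k)) ->
  (forall k x, 0 <= h_ k x <= M%:E) -> (forall x, h_ ^~ x @ \oo --> h x) ->
  forall x, iter n (transition p (pi_ k)) (h_ k) x @[k --> \oo] -->
            iter n (transition p pi) h x.
Proof.
move=> mh_ hM h_h; elim: n => [//|n IH] x /=.
apply: (@setwise_integral_cvg _ _ _ _ _ _ _ M).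
- exact: induced_kernel_cvg.
- by move=> k; exact: induced_kernelT.
- exact: induced_kernelT.
- by move=> k; have [] := iter_transition_bounds p (pi_ k) n (mh_ k) (hM k).
- by move=> k; have [] := iter_transition_bounds p (pi_ k) n (mh_ k) (hM k).
- exact: IH.
Qed.

Lemma expected_stage_cvg (mu : probability X R) n (g : X * A -> \bar R) (M : R) :
  measurable_fun [set: X * A] g -> (forall y, 0 <= g y <= M%:E) ->
  seq_continuous_action g ->
  expected p (pi_ k) mu (fun w => g (w n)) @[k --> \oo] -->
  expected p pi mu (fun w => g (w n)).
Proof.
move=> mg gM cg.
have g0 y : 0 <= g y by have /andP[] := gM y.
rewrite expected_stage//; under eq_fun do rewrite expected_stage//.
have bounds k := iter_transition_bounds p (pi_ k) n
  (measurable_action_mean (pi_ k) mg g0) (fun x => action_mean_bounds (pi_ k) x mg gM).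
apply: (@setwise_integral_cvg _ _ _ _ _ _ _ M).
- by move=> B _; exact: cvg_cst.
- by move=> _; exact: probability_setT.
- exact: probability_setT.
- by move=> k; have [] := bounds k.
- by move=> k; have [] := bounds k.
- apply: (@iter_transition_cvg _ _ _ M).
  + by move=> k; exact: measurable_action_mean.
  + by move=> k x; exact: action_mean_bounds.
  + by move=> x; exact: pi_pi gM cg.
Qed.

Lemma total_cost_cvg (c_ : nat -> X * A -> R) (mu : probability X R) :
  (forall n, measurable_fun [set: X * A] (c_ n)) ->
  (forall n y, (0 <= c_ n y)%R) ->
  (forall n, exists M : R, forall y, (c_ n y <= M)%R) ->
  (forall n (x : X), continuous (fun a : A => c_ n (x, a))) ->
  (forall e : R, (0 < e)%R -> exists N, forall eta : R.-pker X ~> A,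
     \sum_(N <= n <oo) expected p eta mu (fun w => (c_ n (w n))%:E) < e%:E) ->
  total_cost p c_ (pi_ k) mu @[k --> \oo] --> total_cost p c_ pi mu.
Proof.
move=> mc c0 cM cc tail.
have mc' n : measurable_fun [set: X * A] (fun y => (c_ n y)%:E).
  exact/measurable_EFinP.
pose u (eta : R.-pker X ~> A) n := expected p eta mu (fun w => (c_ n (w n))%:E).
have u0 eta n : 0 <= u eta n by apply: integral_ge0 => w _; rewrite lee_fin.
have bounded n : exists M : R, forall y, (0 <= c_ n y <= M)%R.
  by have [M HM] := cM n; exists M => y; rewrite c0/=.
have ufin eta n : u eta n \is a fin_num.
  have [M HM] := bounded n.
  have /andP[_ uM] := expected_bounds p eta mu n (mc n) HM.
  by rewrite ge0_fin_numE// (le_lt_trans uM)// ltry.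
have pfin N eta : \sum_(0 <= n < N) u eta n \is a fin_num.
  by rewrite sum_fin_num; apply/allP => _ /mapP[n _ ->]; exact: ufin.
have split_at N eta : total_cost p c_ eta mu =
    \sum_(0 <= n < N) u eta n + \sum_(N <= n <oo) u eta n.
  by rewrite total_cost_series// (nneseries_split 0 N (fun n _ => u0 eta n)) add0n.
have tail_dist eta (e : R) N : \sum_(N <= n <oo) u eta n < e%:E ->
    `|\sum_(0 <= n < N) u eta n - total_cost p c_ eta mu| < e%:E.
  move=> tN; have t0 : 0 <= \sum_(N <= n <oo) u eta n by exact: nneseries_ge0.
  rewrite (split_at N) oppeD; last by rewrite fin_num_adde_defr.
  by rewrite addeA subee// add0e abseN gee0_abs.
apply: cvg_uniform_approx => e e0; have [N tN] := tail e e0.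
exists (fun k => \sum_(0 <= n < N) u (pi_ k) n), (\sum_(0 <= n < N) u pi n).
split.
- by split=> [|k]; exact: pfin.
- apply: cvg_nnesum => [n _|n _]; first by apply: nearW => k; exact: u0.
  have [M HM] := bounded n.
  apply: (@expected_stage_cvg _ _ (fun y => (c_ n y)%:E) M) => //.
  exact: seq_continuous_EFin.
- by move=> k; apply: tail_dist; exact: tN.
- by apply: tail_dist; exact: tN.
Qed.

(** Pass to the setwise limit on both sides of [nu_n Q_n = nu_n]. *)
Lemma invariant_setwise_limit (k : nat -> nat) (nu_ : nat -> probability X R)
    (nu : probability X R) : (forall n, (n <= k n)%N) ->
  (forall n, invariant_measure p (pi_ (k n)) (nu_ n)) ->
  setwise_cvg (fun n => nu_ n) nu -> invariant_measure p pi nu.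
Proof.
move=> nk inv nu_nu B mB.
apply: (@cvg_unique _ (@ereal_hausdorff R) (nu_ n B @[n --> \oo])); last exact: nu_nu.
have -> : (fun n => nu_ n B) = (fun n => \int[nu_ n]_x induced_kernel p (pi_ (k n)) x B).
  by apply/funext => n; exact/esym/inv.
apply: (@setwise_integral_cvg _ _ _ (fun n => nu_ n) nu
  (fun n x => induced_kernel p (pi_ (k n)) x B) _ 1).
- exact: nu_nu.
- by move=> n; exact: probability_setT.
- exact: probability_setT.
- by move=> n; exact: measurable_induced_kernel.
- by move=> n x; exact: induced_kernel_bounds.
- move=> x; exact: (cvg_comp _ _ (cvg_infty_ge nk)
    (@induced_kernel_cvg x B mB)).
Qed.

Variable nu : (R.-pker X ~> A) -> probability X R.
Hypothesis nu_inv : forall eta, unique_invariant_measure p eta (nu eta).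

(** A sequence converges as soon as each subsequence has a further subsequence
    with the same limit; here every limit is the invariant measure of [pi]. *)
Lemma invariant_cvg_compact :
  setwise_relatively_seq_compact (invariant_measures p) ->
  setwise_cvg (fun k => nu (pi_ k)) (nu pi).
Proof.
move=> cpt B mB; apply: cvg_subsequence => s ns.
have [] := cpt (fun n => nu (pi_ (s n))).
  by move=> n; exists (pi_ (s n)); have [] := nu_inv (pi_ (s n)).
move=> r [nu' [r_incr nu_nu']].
have nr n : (n <= r n)%N.
  by elim: n => // n IH; exact: leq_ltn_trans IH (r_incr n n.+1 (ltnSn n)).
have nu'_inv : invariant_measure p pi nu'.
  apply: (@invariant_setwise_limit (s \o r) _ nu' _ _ nu_nu').
  - by move=> n; exact: leq_trans (nr n) (ns (r n)).
  - by move=> n; have [] := nu_inv (pi_ (s (r n))).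
have [_ /(_ nu' nu'_inv B mB) <-] := nu_inv pi.
by exists r => //; exact: nu_nu'.
Qed.

Lemma induced_kernel_iter_cvg n x B : measurable B ->
  induced_kernel_iter p (pi_ k) n x B @[k --> \oo] --> induced_kernel_iter p pi n x B.
Proof.
move=> mB; rewrite induced_kernel_iterE.
under eq_fun do rewrite induced_kernel_iterE.
apply: (@iter_transition_cvg n (fun _ y => \d_y B) _ 1).
- by move=> _; exact: measurable_fun_dirac.
- by move=> _ y; rewrite measure_ge0/= probability_le1.
- by move=> y; exact: cvg_cst.
Qed.

(** At a time N that serves all policies, the N-step transition probability of B
    from x' is within e of the invariant one, and it converges in k. *)
Lemma invariant_cvg_uniform (x' : X) :
  (forall B, measurable B -> forall e : R, (0 < e)%R ->
     exists N : nat, forall n, (N <= n)%N -> forall eta : R.-pker X ~> A,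
       `| induced_kernel_iter p eta n x' B - nu eta B | < e%:E) ->
  setwise_cvg (fun k => nu (pi_ k)) (nu pi).
Proof.
move=> unif B mB; apply: cvg_uniform_approx => e e0.
have [N /(_ N (leqnn N)) near_nu] := unif B mB e e0.
have iterfin eta : induced_kernel_iter p eta N x' B \is a fin_num.
  have : 0 <= induced_kernel_iter p eta N x' B <= 1%:E.
    rewrite induced_kernel_iterE.
    have [||_] := @iter_transition_bounds _ _ _ _ _ p eta N (fun y => \d_y B) 1.
    - exact: measurable_fun_dirac.
    - by move=> y; rewrite measure_ge0/= probability_le1.
    - exact.
  by move=> /andP[i0 i1]; rewrite ge0_fin_numE// (le_lt_trans i1)// ltry.
exists (fun k => induced_kernel_iter p (pi_ k) N x' B),
  (induced_kernel_iter p pi N x' B); split => //.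
- exact: induced_kernel_iter_cvg.
Qed.

Lemma average_cost_cvg (c : X * A -> R) (M : R) (mu : probability X R) (x : X) :
  measurable_fun [set: X * A] c -> (forall y, (0 <= c y <= M)%R) ->
  (forall x, continuous (fun a : A => c (x, a))) ->
  setwise_cvg (fun k => nu (pi_ k)) (nu pi) ->
  (forall eta, ergodic_states p c eta (nu eta) x) ->
  (forall B, measurable B -> mu B = \d_x B) ->
  average_cost p c (pi_ k) mu @[k --> \oo] --> average_cost p c pi mu.
Proof.
move=> mc cM cc nu_nu erg mux.
rewrite (average_cost_ergodic mc cM (erg pi) mux).
under eq_fun do rewrite (average_cost_ergodic mc cM (erg _) mux).
have mc' : measurable_fun [set: X * A] (fun y => (c y)%:E) by exact/measurable_EFinP.
apply: (@setwise_integral_cvg _ _ _ _ _ _ _ M).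
- exact: nu_nu.
- by move=> k; exact: probability_setT.
- exact: probability_setT.
- move=> k; apply: measurable_action_mean => // y.
  by have /andP[? _] := cM y; rewrite lee_fin.
- by move=> k y; apply: action_mean_bounds => // z; rewrite !lee_fin.
- by move=> y; apply: (pi_pi (M := M)) => //; exact: seq_continuous_EFin.
Qed.

End policy_convergence.

(** * The quantized approximations have converging costs *)

Theorem theoremV1 (dX dA : measure_display) (R : realType)
  (X : polishType R dX) (A : polishType R dA)
  (p : R.-pker (X * A) ~> X) (mu : probability X R)
  (c : X * A -> R) (c_ : nat -> X * A -> R)
  (* (a) *)
  (p_cont : forall (x : X) (a_ : nat -> A) (a : A),
    a_ @ \oo --> a -> setwise_cvg (fun n => p (x, a_ n)) (p (x, a)))
  (* (b) *)
  (A_compact : compact [set: A])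
  (* (c) *)
  (c_meas : measurable_fun [set: X * A] c)
  (c_ge0 : forall y, (0 <= c y)%R)
  (c_bounded : exists M : R, forall y, (c y <= M)%R)
  (c_cont : forall x : X, continuous (fun a : A => c (x, a)))
  (cn_meas : forall n, measurable_fun [set: X * A] (c_ n))
  (cn_ge0 : forall n y, (0 <= c_ n y)%R)
  (cn_bounded : forall n, exists M : R, forall y, (c_ n y <= M)%R)
  (cn_cont : forall n (x : X), continuous (fun a : A => c_ n (x, a)))
  (* the quantized approximations pi_ k, k >= 1, of pi *)
  (pi : R.-pker X ~> A) (pi_ : nat -> R.-pker X ~> A)
  (L : nat -> set A) (f : X * R -> A) (q : nat -> X * R -> A)
  (L_net : forall k, (0 < k)%N -> finite_net k (L k))
  (f_pi : represents f pi)
  (q_quantizer : forall k, (0 < k)%N -> quantizer f (L k) (q k))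
  (pi_q : forall k, (0 < k)%N -> induced_by_quantizer (q k) (pi_ k)) :
  [/\ (* (1) *)
      forall beta : R, (0 < beta < 1)%R ->
        discounted_cost p beta c (pi_ k) mu @[k --> \oo]
          --> discounted_cost p beta c pi mu,
      (* (2) *)
      ereal_sup [set \sum_(N.+1 <= n <oo)
                       expected p eta mu (fun w => (c_ n (w n))%:E)
                | eta in [set: R.-pker X ~> A]] @[N --> \oo] --> 0 ->
      total_cost p c_ (pi_ k) mu @[k --> \oo] --> total_cost p c_ pi mu
    & (* (3) *)
      forall nu : (R.-pker X ~> A) -> probability X R,
        (forall eta, unique_invariant_measure p eta (nu eta)) ->
        let M := \bigcap_(eta in [set: R.-pker X ~> A])
                   ergodic_states p c eta (nu eta) in
        M !=set0 ->
        setwise_relatively_seq_compact (invariant_measures p)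
        \/ (exists x' : X, forall B, measurable B ->
              forall e : R, (0 < e)%R ->
              exists N : nat, forall n, (N <= n)%N ->
              forall eta : R.-pker X ~> A,
                `| induced_kernel_iter p eta n x' B - nu eta B | < e%:E) ->
        forall x, M x -> (forall B, measurable B -> mu B = \d_x B) ->
        average_cost p c (pi_ k) mu @[k --> \oo] --> average_cost p c pi mu].
Proof.
have pi_pi : policy_cvg pi_ pi := quantized_policy_cvg L_net f_pi q_quantizer pi_q.
have [M cM] := c_bounded.
have c0M y : (0 <= c y <= M)%R by rewrite c_ge0 cM.
split.
- (* The discounted cost is the total cost of the stage costs beta ^ n c. *)
  move=> beta beta01; have /andP[b0 b1] := beta01.
  have bn0 n : (0 <= beta ^+ n)%R by rewrite exprn_ge0// ltW.
  apply: (total_cost_cvg p_cont pi_pi (c_ := fun n y => (beta ^+ n * c y)%R)).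
  + by move=> n; exact: measurable_funM.
  + by move=> n y; rewrite mulr_ge0.
  + by move=> n; exists (beta ^+ n * M)%R => y; rewrite ler_wpM2l.
  + by move=> n x a; apply: cvgM; [exact: cvg_cst|exact: c_cont].
  + by move=> e e0; exact: discounted_tail c_meas c0M beta01 e0.
- move=> tails; apply: (total_cost_cvg p_cont pi_pi) => // e e0.
  have /fine_cvgP[tfin /cvgrPdist_lt/(_ e e0) tlt] := tails.
  have [N _ /(_ N (leqnn N))[/= tNfin tN]] := filterI tfin tlt.
  exists N.+1 => eta; apply: (@le_lt_trans _ _ (ereal_sup [set
      \sum_(N.+1 <= n <oo) expected p eta mu (fun w => (c_ n (w n))%:E)
    | eta in [set: R.-pker X ~> A]])).
    by apply: ereal_sup_ubound; exists eta.
  rewrite -(fineK tNfin) lte_fin; apply: le_lt_trans tN.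
  by rewrite sub0r normrN ler_norm.
- move=> nu nu_inv Merg _ compact_or_uniform x Mx mux.
  apply: (average_cost_cvg pi_pi c_meas c0M c_cont (nu := nu) (x := x)) => //.
    case: compact_or_uniform => [cpt|[x' unif]].
      exact: (invariant_cvg_compact p_cont pi_pi nu_inv cpt).
    exact: (invariant_cvg_uniform p_cont pi_pi unif).
  by move=> eta; exact: Mx.
Qed.
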